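(* Let each $f_i:\mathbb{R}^d\to\mathbb{R}$ ($i\in[n]$) be convex and $L_i$-smooth with $L_i>0$, let $f=\frac1n\sum_{i=1}^nf_i$ have a minimizer $\mathbf{x}_*\in\mathbb{R}^d$, and let $\sigma_*^2=\frac1n\sum_{i=1}^n\|\nabla f_i(\mathbf{x}_* )\|_2^2$ (assumed finite). Run shuffled SGD (Algorithm 2, described in the context) for $K\ge1$ epochs with batch size $b$ and a fixed permutation $\pi^{(k)}=\pi^{(0)}$ for all $k$, and write $\hat L^g_0=\hat L^g_{\pi^{(0)}}$, $\tilde L^g_0=\tilde L^g_{\pi^{(0)}}$. If the step sizes satisfy $0<\eta_k\le\frac{b}{n\sqrt{2\hat L^g_0\tilde L^g_0}}$ for all $k\in[K]$ and $H_K=\sum_{k=1}^K\eta_k$, then the output $\hat{\mathbf{x}}_K$ satisfies $$H_K\big(f(\hat{\mathbf{x}}_K)-f(\mathbf{x}_* )\big)\le\frac{b}{2n}\|\mathbf{x}_0-\mathbf{x}_*\|_2^2+\sum_{k=1}^K\min\Big\{\frac{\eta_k^3n}{b^2}\hat L^g_0\tilde L^g_0\|\mathbf{y}_*\|^2_{\boldsymbol\Lambda^{-1}},\ \frac{\eta_k^3(n-b)^2}{b^2}\tilde L^g_0\sigma_*^2\Big\}.$$ Consequently, for any $\epsilon>0$, there exists a constant step size $\eta_k=\eta$ such that $f(\hat{\mathbf{x}}_K)-f(\mathbf{x}_* )\le\epsilon$ after $$\mathcal{O}\Big(\frac{n\sqrt{\hat L^g_0\tilde L^g_0}\|\mathbf{x}_0-\mathbf{x}_*\|_2^2}{\epsilon}+\frac{\min\big\{\sqrt{n\hat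 L^g_0\tilde L^g_0}\|\mathbf{y}_*\|_{\boldsymbol\Lambda^{-1}},\,(n-b)\sqrt{\tilde L^g_0}\,\sigma_*\big\}\|\mathbf{x}_0-\mathbf{x}_*\|_2^2}{\epsilon^{3/2}}\Big)$$ individual gradient queries; that is, there is an absolute constant $C>0$ such that for every $\epsilon>0$ and every integer $K\ge1$ with $nK$ at least $C$ times the expression inside $\mathcal{O}(\cdot)$, some constant step size $\eta>0$ gives $f(\hat{\mathbf{x}}_K)-f(\mathbf{x}_* )\le\epsilon$.
   Context: Setting: $n,d,b,m\ge1$ are integers with $n=bm$; $[n]=\{1,\dots,n\}$. A differentiable $f_i$ is $L_i$-smooth if $\|\nabla f_i(\mathbf{x})-\nabla f_i(\mathbf{y})\|_2\le L_i\|\mathbf{x}-\mathbf{y}\|_2$ for all $\mathbf{x},\mathbf{y}\in\mathbb{R}^d$. $f_i^*$ denotes the convex conjugate of $f_i$. $\|\cdot\|_2$ is the Euclidean norm for vectors and the operator norm for matrices; for positive definite $\mathbf{M}$, $\|\mathbf{y}\|_{\mathbf{M}}=\sqrt{\mathbf{y}^\top\mathbf{M}\mathbf{y}}$. $\mathbf{E}\in\mathbb{R}^{nd\times d}$ is the vertical concatenation of $n$ copies of the identity $\mathbf{I}_d$, and $\mathbf{E}_b\in\mathbb{R}^{bd\times d}$ the vertical concatenation of $b$ copies of $\mathbf{I}_d$. For a permutation $\pi$ of $[n]$, $\boldsymbol\Lambda_\pi\in\mathbb{R}^{nd\times nd}$ is the diagonal matrix with diagonal $L_{\pi_1}$ repeated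 $d$ times, then $L_{\pi_2}$ repeated $d$ times, ..., then $L_{\pi_n}$ repeated $d$ times; $\boldsymbol\Lambda$ is the same matrix for the identity permutation. $\mathbf{y}_*=(\mathbf{y}_*^1,\dots,\mathbf{y}_*^n)\in\mathbb{R}^{nd}$ has blocks $\mathbf{y}_*^i=\operatorname{argmax}_{\mathbf{y}\in\mathbb{R}^d}\{\langle\mathbf{y},\mathbf{x}_*\rangle-f_i^*(\mathbf{y})\}=\nabla f_i(\mathbf{x}_* )$. $\mathbf{I}_{j\uparrow}$ is the $nd\times nd$ identity matrix with its first $j$ diagonal entries set to zero; $\mathbf{I}_{(di)}$ is the $nd\times nd$ diagonal matrix with diagonal entries $1$ in positions $bd(i-1)+1,\dots,bdi$ and $0$ elsewhere. Define $$\hat L^g_\pi=\frac1{mn}\Big\|\boldsymbol\Lambda_\pi^{1/2}\Big(\sum_{i=1}^m\mathbf{I}_{bd(i-1)\uparrow}\mathbf{E}\mathbf{E}^\top\mathbf{I}_{bd(i-1)\uparrow}\Big)\boldsymbol\Lambda_\pi^{1/2}\Big\|_2,\qquad\tilde L^g_\pi=\frac1b\Big\|\boldsymbol\Lambda_\pi^{1/2}\Big(\sum_{i=1}^m\mathbf{I}_{(di)}\mathbf{E}\mathbf{E}^\top\mathbf{I}_{(di)}\Big)\boldsymbol\Lambda_\pi^{1/2}\Big\|_2 .$$ Algorithm 2 (shuffled SGD, primal-dual view). Input: $\mathbf{x}_0\in\mathbb{R}^d$, batch size $b$, step sizes $\eta_k>0$, number of epochs $K$. For $k=1,\dots,K$: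 choose a permutation $\pi^{(k)}$ of $[n]$ (here always $\pi^{(0)}$); set $\mathbf{x}_{k-1,1}=\mathbf{x}_{k-1}$; for $i=1,\dots,m$ set $\mathbf{y}_k^{(i)}=\operatorname{argmax}\{\langle\mathbf{E}_b^\top\mathbf{y}^{(i)},\mathbf{x}_{k-1,i}\rangle-\sum_{j=1}^bf^*_{\pi^{(k)}_{b(i-1)+j}}(\mathbf{y}^j)\}$ over $\mathbf{y}^{(i)}=(\mathbf{y}^1,\dots,\mathbf{y}^b)\in\mathbb{R}^{bd}$ with $\mathbf{y}^j\in\mathbb{R}^d$, and $\mathbf{x}_{k-1,i+1}=\operatorname{argmin}_{\mathbf{x}\in\mathbb{R}^d}\{\langle\mathbf{E}_b^\top\mathbf{y}_k^{(i)},\mathbf{x}\rangle+\frac{b}{2\eta_k}\|\mathbf{x}-\mathbf{x}_{k-1,i}\|_2^2\}$; then set $\mathbf{x}_k=\mathbf{x}_{k-1,m+1}$. Equivalently, $\mathbf{x}_{k-1,i+1}=\mathbf{x}_{k-1,i}-\frac{\eta_k}{b}\sum_{j=b(i-1)+1}^{bi}\nabla f_{\pi_j^{(k)}}(\mathbf{x}_{k-1,i})$. Output: $\hat{\mathbf{x}}_K=\sum_{k=1}^K\eta_k\mathbf{x}_k/\sum_{k=1}^K\eta_k$. Each epoch uses $n$ individual gradient queries. *)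

(* Defs.v *)
From HB Require Import structures.
From mathcomp Require Import all_boot all_order all_algebra all_fingroup.
From mathcomp Require Import all_classical all_reals all_analysis.

Set Implicit Arguments.
Unset Strict Implicit.
Unset Printing Implicit Defensive.

Import Order.TTheory GRing.Theory Num.Theory.
Import numFieldNormedType.Exports.
Local Open Scope classical_set_scope.
Local Open Scope ring_scope.

(* The norm MathComp-Analysis puts on matrices is the max norm; it is used only
   through the topology underlying [differentiable] and ['D_v f], which does not
   depend on the choice of norm. All metric quantities use [enorm]. *)
Definition inner (R : realType) (N : nat) (u v : 'cV[R]_N) : R :=
  (u^T *m v) ord0 ord0.

Definition enorm (R : realType) (N : nat) (u : 'cV[R]_N) : R :=
  Num.sqrt (inner u u).

Definition opnorm (R : realType) (p q : nat) (A : 'M[R]_(p, q)) : R :=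
  sup [set enorm (A *m u) | u in [set u : 'cV[R]_q | enorm u <= 1]].

Definition wnorm (R : realType) (N : nat) (M : 'M[R]_N) (y : 'cV[R]_N) : R :=
  Num.sqrt (inner y (M *m y)).

Definition grad (R : realType) (d : nat) (f : 'cV[R]_d -> R) (x : 'cV[R]_d) :
    'cV[R]_d :=
  \col_i 'D_(delta_mx i ord0) f x.

Definition smooth_with (R : realType) (d : nat) (L : R)
    (f : 'cV[R]_d -> R) : Prop :=
  (forall x, differentiable f x) /\
  (forall x y, enorm (grad f x - grad f y) <= L * enorm (x - y)).

Definition conjugate (R : realType) (d : nat) (f : 'cV[R]_d -> R)
    (y : 'cV[R]_d) : \bar R :=
  ereal_sup [set (inner y x - f x)%:E | x in [set: 'cV[R]_d]].

(* [get] returns an element of the set when it is nonempty; for the objectives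
   below the optimizer exists and is unique, the f_i being convex and smooth. *)
Definition argmax (T : pointedType) (disp : Order.disp_t) (V : porderType disp)
    (F : T -> V) : T :=
  get [set y | forall z, (F z <= F y)%O].

Definition argmin (T : pointedType) (disp : Order.disp_t) (V : porderType disp)
    (F : T -> V) : T :=
  get [set y | forall z, (F y <= F z)%O].

(* Indices are 0-based: a vector of length r * s is made of r consecutive blocks
   of length s, and position i * s + j is entry j of block i. *)
Lemma pos_subproof (r s : nat) (i : 'I_r) (j : 'I_s) : (i * s + j < r * s)%N.
Proof.
apply: (@leq_trans (i.+1 * s)); last by rewrite leq_mul2r ltn_ord orbT.
by rewrite mulSn addnC ltn_add2r.
Qed.

Definition pos (r s : nat) (i : 'I_r) (j : 'I_s) : 'I_(r * s) :=
  Ordinal (pos_subproof i j).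

Lemma blk_subproof (r s : nat) (p : 'I_(r * s)) : (p %/ s < r)%N.
Proof.
have s0 : (0 < s)%N by case: s p => [|s] // [p]; rewrite /= muln0.
by rewrite ltn_divLR.
Qed.

Definition blk (r s : nat) (p : 'I_(r * s)) : 'I_r := Ordinal (blk_subproof p).

Lemma off_subproof (r s : nat) (p : 'I_(r * s)) : (p %% s < s)%N.
Proof.
have s0 : (0 < s)%N by case: s p => [|s] // [p]; rewrite /= muln0.
by rewrite ltn_mod.
Qed.

Definition off (r s : nat) (p : 'I_(r * s)) : 'I_s := Ordinal (off_subproof p).

Definition block (R : realType) (r s : nat) (y : 'cV[R]_(r * s)) (i : 'I_r) :
    'cV[R]_s :=
  \col_q y (pos i q) ord0.

Definition concat (R : realType) (r s : nat) (Y : 'I_r -> 'cV[R]_s) :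
    'cV[R]_(r * s) :=
  \col_p Y (blk p) (off p) ord0.

(* The vertical concatenation of r copies of the identity of size d. *)
Definition stackI (R : realType) (r d : nat) : 'M[R]_(r * d, d) :=
  \matrix_(p, q) (off p == q)%:R.

Definition Lambda (R : realType) (n d : nat) (L : 'I_n -> R) (pi : 'S_n) :
    'M[R]_(n * d) :=
  diag_mx (\row_p L (pi (blk p))).

(* The square root of a nonnegative diagonal matrix is taken entrywise. *)
Definition Lambda_sqrt (R : realType) (n d : nat) (L : 'I_n -> R) (pi : 'S_n) :
    'M[R]_(n * d) :=
  map_mx Num.sqrt (Lambda d L pi).

Definition I_up (R : realType) (N j : nat) : 'M[R]_N :=
  diag_mx (\row_(p < N) (j <= p)%N%:R).

Definition I_batch (R : realType) (N b d i : nat) : 'M[R]_N :=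
  diag_mx (\row_(p < N) (b * d * i <= p < b * d * i.+1)%N%:R).

(* From here on the number of components is m * b: an epoch has m consecutive
   batches of size b, and [pos i j] is the j-th index of batch i. *)
Definition Lhat (R : realType) (m b d : nat) (L : 'I_(m * b) -> R)
    (pi : 'S_(m * b)) : R :=
  let E := stackI R (m * b) d in
  (m%:R * (m * b)%:R)^-1 *
  opnorm (Lambda_sqrt d L pi *m
    (\sum_(i < m) (I_up R (m * b * d) (b * d * i) *m E *m E^T
                     *m I_up R (m * b * d) (b * d * i))) *m
    Lambda_sqrt d L pi).

Definition Ltilde (R : realType) (m b d : nat) (L : 'I_(m * b) -> R)
    (pi : 'S_(m * b)) : R :=
  let E := stackI R (m * b) d in
  b%:R^-1 *
  opnorm (Lambda_sqrt d L pi *m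
    (\sum_(i < m) (I_batch R (m * b * d) b d i *m E *m E^T
                     *m I_batch R (m * b * d) b d i)) *m
    Lambda_sqrt d L pi).

Definition favg (R : realType) (n d : nat) (f : 'I_n -> 'cV[R]_d -> R)
    (x : 'cV[R]_d) : R :=
  n%:R^-1 * \sum_(i < n) f i x.

Definition ystar (R : realType) (n d : nat) (f : 'I_n -> 'cV[R]_d -> R)
    (xs : 'cV[R]_d) : 'cV[R]_(n * d) :=
  concat (fun i =>
    argmax (fun y : 'cV[R]_d => (inner y xs)%:E - conjugate (f i) y)%E).

Definition sigma2 (R : realType) (n d : nat) (f : 'I_n -> 'cV[R]_d -> R)
    (xs : 'cV[R]_d) : R :=
  n%:R^-1 * \sum_(i < n) enorm (grad (f i) xs) ^+ 2.

Definition dual_step (R : realType) (m b d : nat)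
    (f : 'I_(m * b) -> 'cV[R]_d -> R) (pi : 'S_(m * b)) (x : 'cV[R]_d)
    (i : 'I_m) : 'cV[R]_(b * d) :=
  argmax (fun y : 'cV[R]_(b * d) =>
    (inner ((stackI R b d)^T *m y) x)%:E
      - \sum_(j < b) conjugate (f (pi (pos i j))) (block y j))%E.

Definition primal_step (R : realType) (b d : nat) (eta : R) (x : 'cV[R]_d)
    (y : 'cV[R]_(b * d)) : 'cV[R]_d :=
  argmin (fun z : 'cV[R]_d =>
    inner ((stackI R b d)^T *m y) z + b%:R / (2 * eta) * enorm (z - x) ^+ 2).

Definition epoch (R : realType) (m b d : nat)
    (f : 'I_(m * b) -> 'cV[R]_d -> R) (pi : 'S_(m * b)) (eta : R)
    (x : 'cV[R]_d) : 'cV[R]_d :=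
  foldl (fun z (i : 'I_m) => primal_step eta z (dual_step f pi z i))
        x (enum 'I_m).

(* [sgd_iter f pi eta x0 k] is x_k; epoch k >= 1 uses [pi k] and [eta k], so
   [pi 0] and [eta 0] are never used. *)
Fixpoint sgd_iter (R : realType) (m b d : nat)
    (f : 'I_(m * b) -> 'cV[R]_d -> R) (pi : nat -> 'S_(m * b))
    (eta : nat -> R) (x0 : 'cV[R]_d) (k : nat) : 'cV[R]_d :=
  if k is k'.+1 then
    epoch f (pi k) (eta k) (sgd_iter f pi eta x0 k')
  else x0.

Definition sgd_output (R : realType) (m b d : nat)
    (f : 'I_(m * b) -> 'cV[R]_d -> R) (pi : nat -> 'S_(m * b))
    (eta : nat -> R) (x0 : 'cV[R]_d) (K : nat) : 'cV[R]_d :=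
  (\sum_(1 <= k < K.+1) eta k)^-1 *:
    \sum_(1 <= k < K.+1) eta k *: sgd_iter f pi eta x0 k.

(* Main.v *)
Require Import Defs.
From HB Require Import structures.
From mathcomp Require Import all_boot all_order all_algebra all_fingroup.
From mathcomp Require Import all_classical all_reals all_analysis.
From mathcomp Require Import ring lra.

Set Implicit Arguments.
Unset Strict Implicit.
Unset Printing Implicit Defensive.

Import Order.TTheory GRing.Theory Num.Theory.
Import numFieldNormedType.Exports.
Local Open Scope classical_set_scope.
Local Open Scope ring_scope.

(** The proof reads shuffled SGD as gradient steps on the batches and compares
    every gradient used in an epoch with the gradients at the end of that epoch and
    at the minimizer.

    By the equality case of the Fenchel-Young inequality, the dual maximizers are
    the gradients of the components, so an epoch from [x] is the trajectory
    [z 0 = x, z 1, ..., z m = w] with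
    [z (i+1) = z i - (eta / b) * (sum of the gradients of batch i at z i)]
    ([argmax_dual], [primal_stepE], [epoch_trajectory]).

    Write [g p] for the gradient of component [p] used in the epoch, [gs p] for its
    gradient at [xs] and [h p] for its gradient at [w] minus [g p]. Cocoercivity
    ([convex_smooth_bregman]), used between [z i] and [xs] and between [w] and
    [z i], bounds [n * (f w - f xs)] by
    [<sum g, w - xs> + sum_p <h p, w - z i> - 1/2 sum |g p - gs p|^2 / L p
     - 1/2 sum |h p|^2 / L p]. Here
    - the first term telescopes over the epochs, since [sum g] is
      [(b / eta) (x - w)];
    - Young's inequality in each batch, weighted by the constant [Lt] (the Gram
      norm of the batches), spends the last term and leaves
      [(b Lt / 2) sum_i |w - z i|^2] ([end_gap_le]);
    - [w - z i] is [-(eta / b)] times the sum of [g] over the batches from [i] on.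
      Splitting [g] into [g - gs] and [gs], the constant [Lh] (the Gram norm of
      the suffixes) controls the first part, and the step-size condition is
      exactly what makes it at most the remaining negative term ([drift_le],
      [epoch_gap_le]).
    What survives is [eta^2 Lt / b] times [suffix_dispersion], the sum of the
    squared norms of the suffix sums of [gs]. It is at most
    [m n Lh |ystar|^2] by the definition of [Lh]; and as the sum of all [gs] is
    zero, counting terms in the other [m - 1] suffixes bounds it by
    [n (n - b)^2 sigma^2 / b]. These give the two arguments of the minimum.

    Summing over the epochs and applying Jensen's inequality to the weighted
    average gives the first claim ([sgd_gap_le]). For the second, the step size is
    the harmonic combination of the largest admissible step and the step balancing
    the two error terms ([step_reaches_eps]); the constant [sqrt 2] suffices. *)

(** * Euclidean geometry and the operator norm *)

Section Euclidean.
Context {R : realType}.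

Section FixedDimension.
Context {N : nat}.
Implicit Types u v w : 'cV[R]_N.

Lemma innerE u v : inner u v = \sum_i u i ord0 * v i ord0.
Proof. by rewrite /inner mxE; apply: eq_bigr => i _; rewrite mxE. Qed.

Lemma innerC u v : inner u v = inner v u.
Proof. by rewrite !innerE; apply: eq_bigr => i _; rewrite mulrC. Qed.

Lemma innerDr u v w : inner u (v + w) = inner u v + inner u w.
Proof. by rewrite /inner mulmxDr mxE. Qed.

Lemma innerZr a u v : inner u (a *: v) = a * inner u v.
Proof. by rewrite /inner -scalemxAr mxE. Qed.

Lemma innerDl u v w : inner (u + v) w = inner u w + inner v w.
Proof. by rewrite innerC innerDr !(innerC w). Qed.

Lemma innerZl a u v : inner (a *: u) v = a * inner u v.
Proof. by rewrite innerC innerZr innerC. Qed.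

Lemma innerNr u v : inner u (- v) = - inner u v.
Proof. by rewrite -scaleN1r innerZr mulN1r. Qed.

Lemma innerNl u v : inner (- u) v = - inner u v.
Proof. by rewrite innerC innerNr innerC. Qed.

Lemma innerBr u v w : inner u (v - w) = inner u v - inner u w.
Proof. by rewrite innerDr innerNr. Qed.

Lemma innerBl u v w : inner (u - v) w = inner u w - inner v w.
Proof. by rewrite innerDl innerNl. Qed.

Lemma inner0r u : inner u 0 = 0.
Proof. by rewrite /inner mulmx0 mxE. Qed.

Lemma inner0l u : inner 0 u = 0.
Proof. by rewrite innerC inner0r. Qed.

Lemma inner_sumr (I : Type) (r : seq I) (P : pred I) (F : I -> 'cV[R]_N) u :
  inner u (\sum_(i <- r | P i) F i) = \sum_(i <- r | P i) inner u (F i).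
Proof. by rewrite /inner mulmx_sumr summxE. Qed.

Lemma inner_suml (I : Type) (r : seq I) (P : pred I) (F : I -> 'cV[R]_N) u :
  inner (\sum_(i <- r | P i) F i) u = \sum_(i <- r | P i) inner (F i) u.
Proof. by rewrite innerC inner_sumr; apply: eq_bigr => i _; rewrite innerC. Qed.

Lemma inner_ge0 u : 0 <= inner u u.
Proof. by rewrite innerE sumr_ge0 // => i _; rewrite -expr2 sqr_ge0. Qed.

Lemma inner_eq0 u : (inner u u == 0) = (u == 0).
Proof.
apply/eqP/eqP => [|->]; last by rewrite inner0r.
rewrite innerE => /eqP; rewrite psumr_eq0 => [/allP u0|i _]; last first.
  by rewrite -expr2 sqr_ge0.
apply/colP => i; rewrite mxE.
by have /u0 := mem_index_enum i; rewrite /= -expr2 sqrf_eq0 => /eqP.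
Qed.

Lemma enorm_ge0 u : 0 <= enorm u.
Proof. exact: sqrtr_ge0. Qed.

Lemma enorm_sqr u : enorm u ^+ 2 = inner u u.
Proof. by rewrite sqr_sqrtr // inner_ge0. Qed.

Lemma enorm_eq0 u : (enorm u == 0) = (u == 0).
Proof. by rewrite -inner_eq0 -enorm_sqr expf_eq0. Qed.

Lemma enorm0 : enorm (0 : 'cV[R]_N) = 0.
Proof. by apply/eqP; rewrite enorm_eq0. Qed.

Lemma enormZ a u : enorm (a *: u) = `|a| * enorm u.
Proof.
by rewrite /enorm innerZl innerZr mulrA -expr2 sqrtrM ?sqr_ge0 // sqrtr_sqr.
Qed.

Lemma enorm_sqrD u v :
  enorm (u + v) ^+ 2 = enorm u ^+ 2 + 2 * inner u v + enorm v ^+ 2.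
Proof. by rewrite !enorm_sqr innerDl !innerDr (innerC v u); ring. Qed.

Lemma enorm_sqrN u : enorm (- u) ^+ 2 = enorm u ^+ 2.
Proof. by rewrite !enorm_sqr innerNl innerNr opprK. Qed.

Lemma enorm_sqrZ a u : enorm (a *: u) ^+ 2 = a ^+ 2 * enorm u ^+ 2.
Proof. by rewrite enormZ exprMn real_normK // num_real. Qed.

Lemma enorm_sqrB u v :
  enorm (u - v) ^+ 2 = enorm u ^+ 2 - 2 * inner u v + enorm v ^+ 2.
Proof. by rewrite enorm_sqrD enorm_sqrN innerNr mulrN. Qed.

Lemma enorm_subC u v : enorm (u - v) = enorm (v - u).
Proof. by rewrite -opprB /enorm innerNl innerNr opprK. Qed.

Lemma cauchy_schwarz u v : inner u v <= enorm u * enorm v.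
Proof.
have [u0|u0] := eqVneq (enorm u) 0.
  by move/eqP: u0; rewrite enorm_eq0 => /eqP ->; rewrite inner0l enorm0 mul0r.
have [v0|v0] := eqVneq (enorm v) 0.
  by move/eqP: v0; rewrite enorm_eq0 => /eqP ->; rewrite inner0r enorm0 mulr0.
have up : 0 < enorm u * enorm v.
  by rewrite mulr_gt0 // lt_neqAle eq_sym enorm_ge0 ?u0 ?v0.
have := sqr_ge0 (enorm (enorm v *: u - enorm u *: v)).
rewrite enorm_sqrB !enorm_sqrZ innerZl innerZr => h.
rewrite -(ler_pM2l up); nra.
Qed.

Lemma abs_cauchy_schwarz u v : `|inner u v| <= enorm u * enorm v.
Proof.
rewrite ler_norml cauchy_schwarz andbT -lerNl -innerNl.
rewrite (le_trans (cauchy_schwarz _ _)) //.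
by rewrite -scaleN1r enormZ normrN1 mul1r.
Qed.

Lemma inner_young a u v : 0 < a ->
  inner u v <= (2 * a)^-1 * enorm u ^+ 2 + a / 2 * enorm v ^+ 2.
Proof.
move=> a0; have := sqr_ge0 (enorm (u - a *: v)).
rewrite enorm_sqrB enorm_sqrZ innerZr => h.
rewrite -subr_ge0 (_ : _ - _ = (2 * a)^-1 * (enorm u ^+ 2 -
  2 * (a * inner u v) + a ^+ 2 * enorm v ^+ 2)); last by field; lra.
by rewrite mulr_ge0 // invr_ge0; lra.
Qed.

Lemma enorm_sqrD_le u v :
  enorm (u + v) ^+ 2 <= 2 * enorm u ^+ 2 + 2 * enorm v ^+ 2.
Proof.
have := sqr_ge0 (enorm (u - v)); rewrite enorm_sqrB enorm_sqrD; lra.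
Qed.

Lemma enorm_sqr_sum_le (I : finType) (P : pred I) (F : I -> 'cV[R]_N) :
  enorm (\sum_(i | P i) F i) ^+ 2 <=
    #|P|%:R * \sum_(i | P i) enorm (F i) ^+ 2.
Proof.
set S := \sum_(i | P i) F i; set c : R := #|_|%:R.
have [c0|c0] := eqVneq c 0.
  rewrite c0 mul0r /S big_pred0 ?enorm0 ?expr0n // => i.
  by have /eqP := c0; rewrite pnatr_eq0 => /eqP /card0_eq /(_ i).
have cp : 0 < c by rewrite lt_neqAle eq_sym c0 ler0n.
(* The variance of the F i around their mean is nonnegative. *)
have : 0 <= \sum_(i | P i) enorm (F i - c^-1 *: S) ^+ 2.
  by apply: sumr_ge0 => i _; exact: sqr_ge0.
under eq_bigr do rewrite enorm_sqrB innerZr enorm_sqrZ.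
rewrite big_split /= sumrB sumr_const -[_ *+ #|P|]mulr_natr -/c.
rewrite -2!mulr_sumr -inner_suml -/S -enorm_sqr => /(mulr_ge0 (ltW cp)) h.
rewrite -subr_ge0; move: h; set U := \sum_(i | P i) _; set T := enorm S ^+ 2.
by rewrite (_ : c * (_ + _) = c * U - T) //; field.
Qed.

End FixedDimension.

Lemma inner_trmx (p q : nat) (A : 'M[R]_(p, q)) u v :
  inner (A *m u) v = inner u (A^T *m v).
Proof. by rewrite /inner trmx_mul mulmxA. Qed.

Lemma enorm_mulmx_bounded (p q : nat) (A : 'M[R]_(p, q)) :
  exists2 B : R, 0 <= B & forall u, enorm (A *m u) <= B * enorm u.
Proof.
exists (Num.sqrt (\sum_i enorm (row i A)^T ^+ 2)); first exact: sqrtr_ge0.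
move=> u; rewrite -(@ler_pXn2r _ 2) ?nnegrE ?enorm_ge0 ?mulr_ge0 ?sqrtr_ge0 //.
rewrite exprMn [X in _ <= X * _]sqr_sqrtr; last first.
  by apply: sumr_ge0 => i _; exact: sqr_ge0.
rewrite enorm_sqr innerE mulr_suml ler_sum // => i _.
have -> : (A *m u) i ord0 = inner (row i A)^T u.
  by rewrite innerE mxE; apply: eq_bigr => j _; rewrite !mxE.
rewrite -expr2 -exprMn -(real_normK (num_real _)).
by rewrite ler_pXn2r ?nnegrE ?mulr_ge0 ?enorm_ge0 // abs_cauchy_schwarz.
Qed.

Lemma opnorm_bound (p q : nat) (A : 'M[R]_(p, q)) u :
  enorm (A *m u) <= opnorm A * enorm u.
Proof.
have [B B0 AB] := enorm_mulmx_bounded A.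
have ub : has_sup [set enorm (A *m u) | u in [set u : 'cV[R]_q | enorm u <= 1]].
  split; first by exists (enorm (A *m 0)), 0 => //=; rewrite enorm0.
  exists B => _ [v /= v1 <-]; rewrite (le_trans (AB v)) //.
  by rewrite -[leRHS]mulr1 ler_wpM2l.
have [u0|u0] := eqVneq (enorm u) 0.
  move/eqP: u0; rewrite enorm_eq0 => /eqP ->.
  by rewrite mulmx0 !enorm0 mulr0.
have up : 0 < enorm u by rewrite lt_neqAle eq_sym u0 enorm_ge0.
rewrite -ler_pdivrMr // mulrC.
have := @sup_upper_bound _ _ ub; apply.
exists ((enorm u)^-1 *: u) => /=.
  by rewrite enormZ ger0_norm ?invr_ge0 ?enorm_ge0 // mulVf.
by rewrite -scalemxAr enormZ ger0_norm // invr_ge0 enorm_ge0.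
Qed.

(** The only way in which operator norms enter the convergence proof. *)
Lemma quadratic_form_opnorm (p : nat) (A : 'M[R]_p) u :
  inner u (A *m u) <= opnorm A * enorm u ^+ 2.
Proof.
rewrite (le_trans (cauchy_schwarz _ _)) // expr2 mulrCA.
by rewrite ler_wpM2l ?enorm_ge0 // opnorm_bound.
Qed.

End Euclidean.

(** * Gradients of convex smooth functions *)

Section Gradient.
Context {R : realType} {d : nat}.
Implicit Types (f : 'cV[R]_d -> R) (x y v : 'cV[R]_d).

Lemma colvec_sum_delta v : v = \sum_i v i ord0 *: delta_mx i ord0.
Proof.
apply/colP => i; rewrite summxE (bigD1 i) //= big1 ?addr0 => [|j ji].
  by rewrite !mxE !eqxx mulr1.
by rewrite !mxE eq_sym (negbTE ji) mulr0.
Qed.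

Lemma derive_grad f x v : differentiable f x -> 'D_v f x = inner (grad f x) v.
Proof.
move=> fx; rewrite deriveE // {1}(colvec_sum_delta v) linear_sum innerE.
by apply: eq_bigr => i _; rewrite linearZ /= mxE deriveE // mulrC.
Qed.

Lemma is_derive_line f x v (t : R) : differentiable f (x + t *: v) ->
  is_derive t 1 (fun s : R => f (x + s *: v)) (inner (grad f (x + t *: v)) v).
Proof.
move=> fx; rewrite -derive_grad //.
have E : (fun h : R => h^-1 *: (((fun s : R => f (x + s *: v)) \o shift t)
    (h *: (1 : R)) - f (x + t *: v))) =
    (fun h => h^-1 *: ((f \o shift (x + t *: v)) (h *: v) - f (x + t *: v))).
  apply/funext => h /=; congr (_ *: (f _ - _)).
  by rewrite scaler1 scalerDl addrCA.
apply: DeriveDef; last by rewrite /derive E.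
by rewrite /derivable E; exact: diff_derivable.
Qed.

Lemma convex_function_le f (t : R) x y :
  convex_function [set: 'cV[R]_d] f -> 0 <= t <= 1 ->
  f (t *: x + (1 - t) *: y) <= t * f x + (1 - t) * f y.
Proof.
move=> cf /andP[t0 t1].
by have := cf (Itv01 t0 t1) x y; rewrite !inE => /(_ I I).
Qed.

(** Convexity bounds each right difference quotient at [x] in the direction
    [y - x] by [f y - f x]; the gradient term is their limit. *)
Lemma convex_ge_tangent f x y :
  convex_function [set: 'cV[R]_d] f -> differentiable f x ->
  f x + inner (grad f x) (y - x) <= f y.
Proof.
move=> cf dfx; rewrite -lerBrDl -derive_grad //.
have /cvg_dnbhs_at_right h := @diff_derivable _ _ _ f x (y - x) dfx.
apply: (cvgr_to_le h); near=> t => /=.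
have t0 : 0 < t by near: t; exact: nbhs_right_gt.
have t1 : t <= 1 by near: t; exact: nbhs_right_le.
rewrite -[_ *: _]/(t^-1 * _) mulrC ler_pdivrMr //.
have := convex_function_le y x cf (_ : 0 <= t <= 1); rewrite ltW //= => /(_ t1).
rewrite (_ : t *: y + _ = t *: (y - x) + x); last first.
  by rewrite scalerBl scalerBr scale1r addrAC -!addrA.
by lra.
Unshelve. all: by end_near.
Qed.

Lemma is_derive_quadratic (a c t : R) :
  is_derive t 1 (fun s : R => s * a + s ^+ 2 * c) (a + 2 * t * c).
Proof.
have did : is_derive t 1 (@id R) 1 by exact: is_derive_id.
have h := is_deriveD (is_deriveZ a did) (is_deriveZ c (is_deriveX 2 did)).
have -> : (fun s : R => s * a + s ^+ 2 * c) = a \*: (@id R) + c \*: (@id R ^+ 2).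
  by apply/funext => s; congr (_ + _); exact: mulrC.
by apply: is_derive_eq h _; rewrite /GRing.scale /= expr1; ring.
Qed.

(** Descent lemma: along the segment, the gap between the two sides has
    nonpositive derivative, by Cauchy-Schwarz and the Lipschitz bound. *)
Lemma smooth_le_quadratic f (L : R) x y : smooth_with L f ->
  f y <= f x + inner (grad f x) (y - x) + L / 2 * enorm (y - x) ^+ 2.
Proof.
move=> [df Lf]; set v := y - x.
pose q (t : R) := f (x + t *: v) - (t * inner (grad f x) v +
  t ^+ 2 * (L / 2 * enorm v ^+ 2)).
have dq (t : R) : is_derive t (1 : R) q
    (inner (grad f (x + t *: v)) v - (inner (grad f x) v + t * (L * enorm v ^+ 2))).
  have := is_derive_line (df (x + t *: v)) => dl.
  have := is_deriveB dl (is_derive_quadratic (inner (grad f x) v)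
    (L / 2 * enorm v ^+ 2) t).
  by move=> h; apply: is_derive_eq h _; lra.
have : q 1 <= q 0.
  apply: (@ler0_derive1_nincr _ q 0 1) => //.
  - move=> t; rewrite in_itv/= => /andP[t0 t1].
    rewrite derive1E derive_val; have := Lf (x + t *: v) x.
    rewrite [x + _]addrC addrK enormZ gtr0_norm // => h.
    rewrite opprD addrA -innerBl subr_le0 (le_trans (cauchy_schwarz _ _)) //.
    rewrite (_ : t * _ = L * (t * enorm v) * enorm v); last by ring.
    by rewrite ler_wpM2r ?enorm_ge0.
  - by apply: derivable_within_continuous => t _; case: (dq t).
rewrite /q expr0n /= !mul0r addr0 subr0 scale0r addr0 scale1r expr1n !mul1r.
have -> : x + v = y by rewrite /v addrC subrK.
by rewrite lerBlDr addrA.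
Qed.

(** Cocoercivity: the tilted function [z |-> f z - inner (grad f x) z] is
    minimized at [x] by convexity, so its value at [x] is at most its value after
    one gradient step of length [1 / L] from [y]. *)
Lemma convex_smooth_bregman f (L : R) x y : 0 < L ->
  convex_function [set: 'cV[R]_d] f -> smooth_with L f ->
  f x + inner (grad f x) (y - x) +
    (2 * L)^-1 * enorm (grad f y - grad f x) ^+ 2 <= f y.
Proof.
move=> L0 cf sf; set g := grad f y - grad f x.
have := convex_ge_tangent (y - L^-1 *: g) cf (sf.1 x).
have := smooth_le_quadratic y (y - L^-1 *: g) sf.
rewrite [y - _ - y]addrAC subrr add0r enorm_sqrN enorm_sqrZ.
rewrite (_ : y - _ - x = (y - x) - L^-1 *: g); last by rewrite addrAC.
rewrite innerNr (innerBr _ (y - x)) !innerZr (_ : grad f y = g + grad f x).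
  rewrite innerDl -enorm_sqr => h1 h2.
  have -> : (2 * L)^-1 = L^-1 - L / 2 * L^-1 ^+ 2 by field; rewrite gt_eqF.
  by nra.
by rewrite subrK.
Qed.

(** The only affine minorant of [f] that touches it at [x] is the tangent. *)
Lemma subgradient_grad f (L : R) x y : 0 < L -> smooth_with L f ->
  (forall z, inner y z - f z <= inner y x - f x) -> y = grad f x.
Proof.
move=> L0 sf hy; set g := y - grad f x.
have := hy (x + L^-1 *: g); have := smooth_le_quadratic x (x + L^-1 *: g) sf.
rewrite [x + _]addrC addrK innerDr !innerZr enorm_sqrZ.
rewrite (_ : inner y g = inner (grad f x) g + enorm g ^+ 2); last first.
  by rewrite enorm_sqr -innerDl addrC subrK.
move=> h1 h2; apply/eqP; rewrite -subr_eq0 -/g -enorm_eq0.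
suff : enorm g ^+ 2 <= 0 by rewrite real_exprn_even_le0 ?num_real // orFb.
have : (2 * L)^-1 * enorm g ^+ 2 <= 0.
  have -> : (2 * L)^-1 = L^-1 - L / 2 * L^-1 ^+ 2 by field; rewrite gt_eqF.
  by nra.
by rewrite pmulr_rle0 // invr_gt0 mulr_gt0.
Qed.

End Gradient.

(** * Algorithmic steps as gradient steps *)

Local Notation conjugate := Defs.conjugate.

Lemma blk_pos (r s : nat) (i : 'I_r) (j : 'I_s) : blk (pos i j) = i.
Proof.
apply/val_inj; rewrite /= divnMDl ?divn_small ?addn0 //.
by case: s j => [|//] [].
Qed.

Lemma off_pos (r s : nat) (i : 'I_r) (j : 'I_s) : off (pos i j) = j.
Proof. by apply/val_inj; rewrite /= modnMDl modn_small. Qed.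

Lemma pos_blk_off (r s : nat) (p : 'I_(r * s)) : pos (blk p) (off p) = p.
Proof. by apply/val_inj; rewrite /= -divn_eq. Qed.

Lemma sum_pos (V : nmodType) (r s : nat) (F : 'I_(r * s) -> V) :
  \sum_p F p = \sum_i \sum_j F (pos i j).
Proof.
rewrite pair_big /=; apply: (reindex (fun ij => pos ij.1 ij.2)).
exists (fun p => (blk p, off p)) => [[i j] _|p _] /=.
  by rewrite blk_pos off_pos.
exact: pos_blk_off.
Qed.

Section Blocks.
Context {R : realType}.

Lemma block_concat (r s : nat) (Y : 'I_r -> 'cV[R]_s) i :
  block (concat Y) i = Y i.
Proof. by apply/colP => q; rewrite !mxE blk_pos off_pos. Qed.

Lemma concat_block (r s : nat) (y : 'cV[R]_(r * s)) : concat (block y) = y.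
Proof. by apply/colP => p; rewrite !mxE pos_blk_off. Qed.

Lemma tr_stackI_mul (r d : nat) (y : 'cV[R]_(r * d)) :
  (stackI R r d)^T *m y = \sum_i block y i.
Proof.
apply/colP => q; rewrite summxE mxE sum_pos; apply: eq_bigr => i _.
rewrite (bigD1 q) //= big1 ?addr0 => [|j jq].
  by rewrite !mxE off_pos eqxx mul1r.
by rewrite !mxE off_pos (negbTE jq) mul0r.
Qed.

End Blocks.

Section Conjugate.
Context {R : realType} {d : nat}.
Implicit Types (f : 'cV[R]_d -> R) (x y : 'cV[R]_d).

Lemma fenchel_young f x y : ((inner y x - f x)%:E <= conjugate f y)%E.
Proof. by apply: ereal_sup_ubound; exists x. Qed.

Lemma conjugate_grad f x : convex_function [set: 'cV[R]_d] f ->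
  differentiable f x ->
  conjugate f (grad f x) = (inner (grad f x) x - f x)%:E.
Proof.
move=> cf df; apply/eqP; rewrite eq_le fenchel_young andbT.
apply: ge_ereal_sup => _ [z _ <-]; rewrite lee_fin.
by have := convex_ge_tangent z cf df; rewrite innerBr; lra.
Qed.

(** Equality in the Fenchel-Young inequality makes the affine function of slope [y]
    a minorant of [f] touching it at [x]. *)
Lemma fenchel_young_equality f (L : R) x y : 0 < L -> smooth_with L f ->
  (conjugate f y <= (inner y x - f x)%:E)%E -> y = grad f x.
Proof.
move=> L0 sf h; apply: (subgradient_grad L0 sf) => z; rewrite -lee_fin.
exact: le_trans (fenchel_young f z y) h.
Qed.

End Conjugate.

Lemma argmax_unique (T : pointedType) (disp : Order.disp_t)
    (V : porderType disp) (F : T -> V) (t : T) :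
  (forall z, (F z <= F t)%O) -> (forall y, (F t <= F y)%O -> y = t) ->
  argmax F = t.
Proof.
move=> ub uniq; apply: uniq.
exact: (@getPex _ [set y | forall z, (F z <= F y)%O] (ex_intro _ t ub) t).
Qed.

Lemma argmin_unique (T : pointedType) (disp : Order.disp_t)
    (V : porderType disp) (F : T -> V) (t : T) :
  (forall z, (F t <= F z)%O) -> (forall y, (F y <= F t)%O -> y = t) ->
  argmin F = t.
Proof.
move=> lb uniq; apply: uniq.
exact: (@getPex _ [set y | forall z, (F y <= F z)%O] (ex_intro _ t lb) t).
Qed.

(** If the sum of terms bounded below by [a i] does not exceed the sum of the
    [a i], every term is tight. This holds although the [c i] may be infinite,
    because the [a i] are finite and can be cancelled. *)
Lemma lee_sum_fin_eq (R : realType) (I : finType) (a : I -> R)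
    (c : I -> \bar R) :
  (forall i, (a i)%:E <= c i)%E -> (\sum_i c i <= (\sum_i a i)%:E)%E ->
  forall i, (c i <= (a i)%:E)%E.
Proof.
move=> ac; rewrite -sumEFin => h i.
rewrite -(@leeD2rE _ (\sum_(j | j != i) (a j)%:E)%E); last first.
  by rewrite sumEFin.
rewrite (le_trans _ (le_trans h _)) //; last by rewrite (bigD1 i).
by rewrite [leRHS](bigD1 i) //= leeD2l // lee_sum.
Qed.

Lemma le_fin_sube (R : realType) (a r : R) (c : \bar R) :
  (a%:E - c <= r%:E)%E = ((a - r)%:E <= c)%E.
Proof.
case: c => [c| |]; last by rewrite [(- -oo)%E]/= addey // leye_eq leeNy_eq.
  by rewrite -EFinB !lee_fin lerBlDr lerBlDl.
by rewrite [(- +oo)%E]/= addeNy leNye leey.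
Qed.

Lemma ge_fin_sube (R : realType) (a r : R) (c : \bar R) :
  (r%:E <= a%:E - c)%E = (c <= (a - r)%:E)%E.
Proof.
case: c => [c| |]; last by rewrite [(- -oo)%E]/= addey // leNye leey.
  by rewrite -EFinB !lee_fin lerBrDr lerBrDl.
by rewrite [(- +oo)%E]/= addeNy leye_eq leeNy_eq.
Qed.

Section DualStep.
Context {R : realType} {d b : nat}.
Variables (f : 'I_b -> 'cV[R]_d -> R) (L : 'I_b -> R).
Hypothesis L0 : forall j, 0 < L j.
Hypothesis f_convex : forall j, convex_function [set: 'cV[R]_d] (f j).
Hypothesis f_smooth : forall j, smooth_with (L j) (f j).

(** The dual objective splits over the blocks, and each summand is at most
    [f j x] by the Fenchel-Young inequality, with equality only at the gradient. *)
Lemma argmax_dual x :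
  argmax (fun y : 'cV[R]_(b * d) => (inner ((stackI R b d)^T *m y) x)%:E
      - \sum_(j < b) conjugate (f j) (block y j))%E =
  concat (fun j => grad (f j) x).
Proof.
set F := (X in argmax X).
have innerS (y : 'cV[R]_(b * d)) :
    inner ((stackI R b d)^T *m y) x = \sum_j inner (block y j) x.
  by rewrite tr_stackI_mul inner_suml.
have FE : F (concat (fun j => grad (f j) x)) = (\sum_j f j x)%:E.
  rewrite /F innerS (eq_bigr (fun j => inner (grad (f j) x) x)); last first.
    by move=> j _; rewrite block_concat.
  rewrite [in X in (_ - X)%E](eq_bigr
    (fun j => (inner (grad (f j) x) x - f j x)%:E)).
    by rewrite sumEFin -EFinB sumrB subKr.
  move=> j _; rewrite block_concat.
  exact: conjugate_grad (f_convex _) ((f_smooth _).1 _).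
have subS (y : 'cV[R]_(b * d)) : \sum_j inner (block y j) x - \sum_j f j x =
    \sum_j (inner (block y j) x - f j x) by rewrite sumrB.
apply: argmax_unique => [y|y]; rewrite FE /F innerS.
  rewrite le_fin_sube subS -sumEFin lee_sum // => j _; exact: fenchel_young.
rewrite ge_fin_sube subS => h.
rewrite -[LHS]concat_block; congr concat; apply/funext => j.
apply: (fenchel_young_equality (L0 j) (f_smooth j)); move: j.
by apply: lee_sum_fin_eq => [j|//]; exact: fenchel_young.
Qed.

End DualStep.

Lemma argmax_fenchel (R : realType) (d : nat) (f : 'cV[R]_d -> R) (L : R) x :
  0 < L -> convex_function [set: 'cV[R]_d] f -> smooth_with L f ->
  argmax (fun y : 'cV[R]_d => (inner y x)%:E - conjugate f y)%E = grad f x.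
Proof.
move=> L0 cf sf; apply: argmax_unique => [y|y].
  rewrite (conjugate_grad cf (sf.1 x)) -EFinB subKr le_fin_sube.
  exact: fenchel_young.
rewrite (conjugate_grad cf (sf.1 x)) -EFinB subKr ge_fin_sube.
exact: (fenchel_young_equality L0 sf).
Qed.

Section Iterations.
Context {R : realType} {m b d : nat}.
Variables (f : 'I_(m * b) -> 'cV[R]_d -> R) (L : 'I_(m * b) -> R).
Hypothesis L0 : forall i, 0 < L i.
Hypothesis f_convex : forall i, convex_function [set: 'cV[R]_d] (f i).
Hypothesis f_smooth : forall i, smooth_with (L i) (f i).

Lemma dual_stepE (pi : 'S_(m * b)) x (i : 'I_m) :
  dual_step f pi x i = concat (fun j => grad (f (pi (pos i j))) x).
Proof.
exact: (@argmax_dual _ _ _ (fun j => f (pi (pos i j)))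
  (fun j => L (pi (pos i j)))).
Qed.

(** Completing the square: the objective is its value at the gradient step plus
    [b / (2 eta)] times the squared distance to that point. *)
Lemma primal_stepE (eta : R) (x : 'cV[R]_d) (y : 'cV[R]_(b * d)) :
  (0 < b)%N -> 0 < eta ->
  primal_step eta x y = x - (eta / b%:R) *: \sum_j block y j.
Proof.
move=> b0 eta0; rewrite /primal_step tr_stackI_mul; set g := \sum_j block y j.
have c0 : 0 < b%:R / (2 * eta) by rewrite divr_gt0 ?ltr0n // mulr_gt0.
have E z : inner g z + b%:R / (2 * eta) * enorm (z - x) ^+ 2 =
    inner g x - eta / (2 * b%:R) * enorm g ^+ 2 +
    b%:R / (2 * eta) * enorm (z - (x - (eta / b%:R) *: g)) ^+ 2.
  rewrite (_ : z - (x - _) = (z - x) + (eta / b%:R) *: g); last first.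
    by rewrite opprB addrCA addrC.
  rewrite [enorm (_ + _ *: _) ^+ 2]enorm_sqrD innerZr enorm_sqrZ.
  rewrite (innerC _ g) innerBr.
  by field; rewrite pnatr_eq0 -lt0n b0 gt_eqF.
apply: argmin_unique => z; rewrite !E subrr enorm0 expr0n /= mulr0 addr0.
  by rewrite lerDl mulr_ge0 ?sqr_ge0 // ltW.
rewrite gerDl pmulr_rle0 // => h; apply/eqP; rewrite -subr_eq0 -enorm_eq0.
by rewrite real_exprn_even_le0 ?num_real // orFb in h.
Qed.

Lemma foldl_trajectory (T : Type) (F : T -> 'I_m -> T) (x : T) :
  exists z : nat -> T, [/\ z 0%N = x, forall i : 'I_m, z i.+1 = F (z i) i &
    z m = foldl F x (enum 'I_m)].
Proof.
exists (fun k => foldl F x (take k (enum 'I_m))); split => [|i|].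
- by rewrite take0.
- by rewrite (take_nth i) ?size_enum_ord // nth_ord_enum foldl_rcons.
- by rewrite take_oversize // size_enum_ord.
Qed.

Lemma epoch_trajectory (pi : 'S_(m * b)) (eta : R) (x : 'cV[R]_d) :
  (0 < b)%N -> 0 < eta ->
  exists z : nat -> 'cV[R]_d, [/\ z 0%N = x,
    forall i : 'I_m,
      z i.+1 = z i - (eta / b%:R) *: \sum_j grad (f (pi (pos i j))) (z i) &
    z m = epoch f pi eta x].
Proof.
move=> b0 eta0.
have [z [z0 zS zm]] := foldl_trajectory
  (fun z (i : 'I_m) => primal_step eta z (dual_step f pi z i)) x.
exists z; split=> // i; rewrite zS primal_stepE // dual_stepE.
by congr (_ - _ *: _); apply: eq_bigr => j _; rewrite block_concat.
Qed.

End Iterations.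

(** * Gram norms controlling sums over batches and suffixes *)

(** Both [I_up] and [I_batch] are diagonal masks constant on the blocks of size
    [d], so the matrices in [Lhat] and [Ltilde] are two instances of one Gram
    matrix, given by a relation [c] selecting the components of the [i]-th sum. *)
Section MaskedGram.
Context {R : realType} {r d k : nat}.
Variables (L : 'I_r -> R) (pi : 'S_r) (D : 'I_k -> 'M[R]_(r * d)).
Variable c : 'I_k -> pred 'I_r.
Hypothesis L0 : forall p, 0 < L p.
Hypothesis DE : forall i, D i = diag_mx (\row_p (c i (blk p))%:R).

Local Notation E := (stackI R r d).
Local Notation A := (\sum_i (D i *m E *m E^T *m D i)).
Local Notation S := (Lambda_sqrt d L pi).

Lemma Lambda_sqrtE : S = diag_mx (\row_p Num.sqrt (L (pi (blk p)))).
Proof.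
apply/matrixP => p q; rewrite !mxE.
by case: eqP => [->|_]; rewrite ?mulr1n // !mulr0n sqrtr0.
Qed.

Lemma Lambda_sqrt_concat (h : 'I_r -> 'cV[R]_d) :
  S *m concat (fun p => (Num.sqrt (L (pi p)))^-1 *: h p) = concat h.
Proof.
apply/colP => p; rewrite Lambda_sqrtE mul_diag_mx !mxE mulVKf //.
by rewrite sqrtr_eq0 -ltNge.
Qed.

Lemma tr_stackI_mask (h : 'I_r -> 'cV[R]_d) i :
  E^T *m (D i *m concat h) = \sum_(p | c i p) h p.
Proof.
rewrite tr_stackI_mul [RHS]big_mkcond /=; apply: eq_bigr => p _.
apply/colP => q; rewrite DE mul_diag_mx !mxE blk_pos off_pos.
by case: (c i p); rewrite ?mul1r // mul0r mxE.
Qed.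

Lemma enorm_sqr_concat (Y : 'I_r -> 'cV[R]_d) :
  enorm (concat Y) ^+ 2 = \sum_p enorm (Y p) ^+ 2.
Proof.
rewrite enorm_sqr innerE sum_pos; apply: eq_bigr => p _.
rewrite enorm_sqr innerE; apply: eq_bigr => q _.
by rewrite !mxE blk_pos off_pos.
Qed.

(** Substituting [u = concat (h p / sqrt (L (pi p)))] in the quadratic form of
    the symmetrized Gram matrix turns the weights into the scaling on the right. *)
Lemma masked_gram_bound (h : 'I_r -> 'cV[R]_d) :
  \sum_i enorm (\sum_(p | c i p) h p) ^+ 2 <=
    opnorm (S *m A *m S) * \sum_p enorm (h p) ^+ 2 / L (pi p).
Proof.
set u := concat (fun p => (Num.sqrt (L (pi p)))^-1 *: h p).
have -> : \sum_p enorm (h p) ^+ 2 / L (pi p) = enorm u ^+ 2.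
  rewrite enorm_sqr_concat; apply: eq_bigr => p _.
  by rewrite enorm_sqrZ exprVn (sqr_sqrtr (ltW (L0 _))) mulrC.
apply: le_trans (quadratic_form_opnorm _ _).
rewrite -!mulmxA.
have ST : S^T = S by rewrite Lambda_sqrtE tr_diag_mx.
have -> : inner u (S *m (A *m (S *m u))) = inner (S *m u) (A *m (S *m u)).
  by rewrite inner_trmx ST.
rewrite Lambda_sqrt_concat mulmx_suml inner_sumr.
rewrite le_eqVlt; apply/orP; left; apply/eqP/eq_bigr => i _.
have DT : (D i)^T = D i by rewrite DE tr_diag_mx.
rewrite -!mulmxA tr_stackI_mask -{1}DT -inner_trmx -{1}[E]trmxK -inner_trmx.
by rewrite tr_stackI_mask enorm_sqr.
Qed.

(** Testing the bound on a family supported at one selected component gives a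
    positive left-hand side. Positivity is needed to divide by these norms in
    Young's inequality and in the step size. *)
Lemma masked_gram_gt0 i p : (0 < d)%N -> c i p -> 0 < opnorm (S *m A *m S).
Proof.
move=> d0 cip; pose e : 'cV[R]_d := const_mx 1.
have e0 : 0 < enorm e ^+ 2.
  rewrite enorm_sqr innerE; under eq_bigr do rewrite !mxE mulr1.
  by rewrite sumr_const card_ord pmulrn_lgt0.
pose h q := if q == p then e else 0.
have hs : \sum_q enorm (h q) ^+ 2 / L (pi q) = enorm e ^+ 2 / L (pi p).
  rewrite (bigD1 p) //= big1 ?addr0 /h ?eqxx // => q /negbTE ->.
  by rewrite enorm0 expr0n mul0r.
have := masked_gram_bound h; rewrite hs => H.
suff : 0 < opnorm (S *m A *m S) * (enorm e ^+ 2 / L (pi p)).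
  by rewrite pmulr_lgt0 // divr_gt0.
apply: lt_le_trans H; rewrite (bigD1 i) //= ltr_pwDl //; last first.
  by apply: sumr_ge0 => j _; exact: sqr_ge0.
rewrite (bigD1 p) //= big1 ?addr0 /h ?eqxx // => q /andP[_ /negbTE -> //].
Qed.

End MaskedGram.

Section Constants.
Context {R : realType} {m b d : nat}.
Variables (L : 'I_(m * b) -> R) (pi : 'S_(m * b)).
Hypothesis L0 : forall p, 0 < L p.
Hypothesis m0 : (0 < m)%N.
Hypothesis b0 : (0 < b)%N.
Hypothesis d0 : (0 < d)%N.

Lemma I_upE (i : 'I_m) : I_up R (m * b * d) (b * d * i) =
  diag_mx (\row_p (b * i <= blk p)%N%:R).
Proof.
congr diag_mx; apply/rowP => p; rewrite !mxE /=.
by rewrite mulnAC leq_divRL.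
Qed.

Lemma I_batchE (i : 'I_m) : I_batch R (m * b * d) b d i =
  diag_mx (\row_p (blk (blk p) == i)%:R).
Proof.
congr diag_mx; apply/rowP => p; rewrite !mxE -val_eqE /=.
rewrite -divnMA eqn_leq -(ltnS _ i) ltn_divLR ?muln_gt0 ?b0 ?d0 //.
by rewrite leq_divRL ?muln_gt0 ?b0 ?d0 // andbC (mulnC d) !(mulnC _ (b * d)).
Qed.

Lemma suffix_sum_bound (h : 'I_(m * b) -> 'cV[R]_d) :
  \sum_(i < m) enorm (\sum_(p : 'I_(m * b) | (b * i <= p)%N) h p) ^+ 2 <=
    m%:R * (m * b)%:R * Lhat d L pi * \sum_p enorm (h p) ^+ 2 / L (pi p).
Proof.
rewrite /Lhat mulVKf ?mulf_neq0 ?pnatr_eq0 -?lt0n ?muln_gt0 ?m0 //.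
exact: (masked_gram_bound pi L0 I_upE).
Qed.

Lemma batch_sum_bound (h : 'I_(m * b) -> 'cV[R]_d) :
  \sum_(i < m) enorm (\sum_(j < b) h (pos i j)) ^+ 2 <=
    b%:R * Ltilde d L pi * \sum_p enorm (h p) ^+ 2 / L (pi p).
Proof.
rewrite /Ltilde mulVKf ?pnatr_eq0 -?lt0n //.
apply: le_trans (masked_gram_bound (c := fun i p => blk p == i) pi L0 I_batchE h).
rewrite le_eqVlt; apply/orP; left; apply/eqP/eq_bigr => i _.
rewrite [in RHS]big_mkcond sum_pos (bigD1 i) //= [X in _ + X]big1 ?addr0.
  by congr (enorm _ ^+ 2); apply: eq_bigr => j _; rewrite /= blk_pos eqxx.
by move=> i' /negbTE ne; apply: big1 => j _; rewrite /= blk_pos ne.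
Qed.

Lemma Lhat_gt0 : 0 < Lhat d L pi.
Proof.
rewrite mulr_gt0 // ?invr_gt0 ?mulr_gt0 ?ltr0n ?muln_gt0 ?m0 //.
by apply: (masked_gram_gt0 (c := fun i p => (b * i <= p)%N) pi L0 I_upE
  (i := Ordinal m0) (p := pos (Ordinal m0) (Ordinal b0))) => //=; rewrite muln0.
Qed.

Lemma Ltilde_gt0 : 0 < Ltilde d L pi.
Proof.
rewrite mulr_gt0 // ?invr_gt0 ?ltr0n //.
by apply: (masked_gram_gt0 (c := fun i p => blk p == i) pi L0 I_batchE
  (i := Ordinal m0) (p := pos (Ordinal m0) (Ordinal b0))) => //=; rewrite blk_pos.
Qed.

End Constants.

(** * Progress of one epoch *)

Lemma suffix_telescope (V : zmodType) (z : nat -> V) (m k : nat) : (k <= m)%N ->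
  \sum_(i < m | (k <= i)%N) (z i - z i.+1) = z k - z m.
Proof.
elim: m => [|m IH]; first by rewrite leqn0 => /eqP ->; rewrite big_ord0 subrr.
rewrite big_mkcond big_ord_recr -big_mkcond /=.
rewrite leq_eqVlt => /orP[/eqP ->|km]; last by rewrite IH // -ltnS km addrA subrK.
by rewrite ltnn addr0 subrr big_pred0 // => i; rewrite leqNgt ltnS ltnW.
Qed.

Lemma sum_suffix_pos (V : nmodType) (m b : nat) (h : 'I_(m * b) -> V) (k : nat) :
  \sum_(p : 'I_(m * b) | (b * k <= p)%N) h p =
    \sum_(i < m | (k <= i)%N) \sum_(j < b) h (pos i j).
Proof.
rewrite big_mkcond sum_pos [RHS]big_mkcond; apply: eq_bigr => i _ /=.
have E (j : 'I_b) : (b * k <= i * b + j)%N = (k <= i)%N.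
  have b0 : (0 < b)%N by exact: leq_ltn_trans (leq0n j) (ltn_ord j).
  by rewrite mulnC -leq_divRL // divnMDl // divn_small // addn0.
case: ifP => ki; first by apply: eq_bigr => j _; rewrite E ki.
by apply: big1 => j _; rewrite E ki.
Qed.

(** A gradient step on the sum, of length the inverse of the total smoothness
    constant, strictly decreases it unless the total gradient is zero; at a
    minimizer no decrease is possible. *)
Lemma sum_grad_minimizer (R : realType) (n d : nat) (f : 'I_n -> 'cV[R]_d -> R)
    (L : 'I_n -> R) xs : (0 < n)%N -> (forall i, 0 < L i) ->
  (forall i, smooth_with (L i) (f i)) -> (forall x, favg f xs <= favg f x) ->
  \sum_i grad (f i) xs = 0.
Proof.
move=> n0 L0 sf xsmin; set s := \sum_i _; pose M := \sum_i L i.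
have M0 : 0 < M.
  rewrite /M (bigD1 (Ordinal n0)) //= ltr_pwDl // sumr_ge0 // => i _.
  exact: ltW.
have := xsmin (xs - M^-1 *: s).
rewrite /favg ler_pM2l ?invr_gt0 ?ltr0n // => h.
have : \sum_i f i (xs - M^-1 *: s) <= \sum_i (f i xs -
    M^-1 * inner (grad (f i) xs) s + L i * (M^-1 ^+ 2 / 2 * enorm s ^+ 2)).
  apply: ler_sum => i _; have := smooth_le_quadratic xs (xs - M^-1 *: s) (sf i).
  rewrite [xs - _]addrC addrK innerNr innerZr enorm_sqrN enorm_sqrZ => h'.
  apply: le_trans h' _; rewrite le_eqVlt; apply/orP; left; apply/eqP.
  by field; rewrite gt_eqF.
rewrite big_split sumrB /= -mulr_sumr -inner_suml -mulr_suml -/s -/M -enorm_sqr.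
move=> /(le_trans h); rewrite (_ : M * _ = M^-1 / 2 * enorm s ^+ 2); last first.
  by field; rewrite gt_eqF.
move=> h'; have : M^-1 * enorm s ^+ 2 <= 0 by lra.
rewrite pmulr_rle0 ?invr_gt0 // => h2; apply/eqP; rewrite -enorm_eq0.
by rewrite real_exprn_even_le0 ?num_real // orFb in h2.
Qed.

Lemma natr_mul_favg (R : realType) (n d : nat) (f : 'I_n -> 'cV[R]_d -> R) x :
  (0 < n)%N -> n%:R * favg f x = \sum_i f i x.
Proof. by move=> n0; rewrite mulVKf // pnatr_eq0 -lt0n. Qed.

Lemma natr_mul_sigma2 (R : realType) (n d : nat) (f : 'I_n -> 'cV[R]_d -> R) x :
  (0 < n)%N -> n%:R * sigma2 f x = \sum_i enorm (grad (f i) x) ^+ 2.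
Proof. by move=> n0; rewrite mulVKf // pnatr_eq0 -lt0n. Qed.

Lemma sum_perm (V : nmodType) (n : nat) (pi : 'S_n) (F : 'I_n -> V) :
  \sum_i F (pi i) = \sum_i F i.
Proof. by rewrite [RHS](reindex_inj (@perm_inj _ pi)). Qed.

Lemma sum_lincomb (R : realFieldType) (I : finType) (A B C D : I -> R) (c : R) :
  \sum_i (A i + B i - c * C i - c * D i) =
    \sum_i A i + \sum_i B i - c * \sum_i C i - c * \sum_i D i.
Proof. by rewrite !sumrB big_split /= -!mulr_sumr. Qed.

Lemma gap_arith (R : realFieldType) (Fw Fs Fz a k gz gw A B : R) :
  Fz - gz + A <= Fs -> Fw + a + B <= Fz -> a + k = gz - gw ->
  Fw - Fs <= k + gw - A - B.
Proof. lra. Qed.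

Lemma drift_arith (R : realFieldType) (S I U V D : R) :
  S <= 2^-1 * V + D -> S + I - 2^-1 * U - 2^-1 * V <= I + D - 2^-1 * U.
Proof. lra. Qed.

Lemma threepoint_arith (R : realFieldType) (A B C : R) :
  0 <= A -> B <= 2^-1 * (A + 2 * B + C - C).
Proof. lra. Qed.

(** The constants enter the analysis of an epoch only through the two quadratic
    bounds below and their positivity, so [Lh] and [Lt] are left abstract. *)
Section Epoch.
Context {R : realType} {m b d : nat}.
Variables (f : 'I_(m * b) -> 'cV[R]_d -> R) (L : 'I_(m * b) -> R).
Variables (pi : 'S_(m * b)) (xs : 'cV[R]_d).
Hypothesis m0 : (0 < m)%N.
Hypothesis b0 : (0 < b)%N.
Hypothesis L0 : forall i, 0 < L i.
Hypothesis f_convex : forall i, convex_function [set: 'cV[R]_d] (f i).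
Hypothesis f_smooth : forall i, smooth_with (L i) (f i).
Hypothesis xs_min : forall x, favg f xs <= favg f x.
Variables Lh Lt : R.
Hypothesis Lh0 : 0 < Lh.
Hypothesis Lt0 : 0 < Lt.
Hypothesis suffix_bound : forall h : 'I_(m * b) -> 'cV[R]_d,
  \sum_(i < m) enorm (\sum_(p : 'I_(m * b) | (b * i <= p)%N) h p) ^+ 2 <=
    m%:R * (m * b)%:R * Lh * \sum_p enorm (h p) ^+ 2 / L (pi p).
Hypothesis batch_bound : forall h : 'I_(m * b) -> 'cV[R]_d,
  \sum_(i < m) enorm (\sum_(j < b) h (pos i j)) ^+ 2 <=
    b%:R * Lt * \sum_p enorm (h p) ^+ 2 / L (pi p).

Local Notation n := (m * b)%N.
Local Notation gs p := (grad (f (pi p)) xs).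

Let bR0 : 0 < b%:R :> R. Proof. by rewrite ltr0n. Qed.
Let nR0 : 0 < n%:R :> R. Proof. by rewrite ltr0n muln_gt0 m0. Qed.

Lemma sum_grad_opt : \sum_p gs p = 0.
Proof.
have n0 : (0 < n)%N by rewrite muln_gt0 m0.
apply: etrans (sum_grad_minimizer n0 L0 f_smooth xs_min).
exact: (sum_perm pi (fun i => grad (f i) xs)).
Qed.

(** How far the suffix sums of the gradients at the minimizer are from vanishing:
    the price of visiting the batches in a fixed order. *)
Definition suffix_dispersion : R :=
  \sum_(i < m) enorm (\sum_(p : 'I_(m * b) | (b * i <= p)%N) gs p) ^+ 2.

Lemma suffix_dispersion_le_Lhat :
  suffix_dispersion <= m%:R * n%:R * Lh * \sum_i enorm (grad (f i) xs) ^+ 2 / L i.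
Proof.
apply: le_trans (suffix_bound _) _.
by rewrite (sum_perm pi (fun i => enorm (grad (f i) xs) ^+ 2 / L i)).
Qed.

(** The first suffix is the whole sum, which vanishes; each of the other [m - 1]
    suffixes has at most [n - b] terms. *)
Lemma suffix_dispersion_le_sigma2 :
  suffix_dispersion <= n%:R * (n%:R - b%:R) ^+ 2 / b%:R * sigma2 f xs.
Proof.
have sE : n%:R * sigma2 f xs = \sum_p enorm (gs p) ^+ 2.
  have n0 : (0 < n)%N by rewrite muln_gt0 m0.
  rewrite (natr_mul_sigma2 _ _ n0).
  exact/esym/(sum_perm pi (fun i => enorm (grad (f i) xs) ^+ 2)).
set S := \sum_p enorm (gs p) ^+ 2 in sE.
have S0 : 0 <= S by apply: sumr_ge0 => p _; exact: sqr_ge0.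
have -> : n%:R * (n%:R - b%:R) ^+ 2 / b%:R * sigma2 f xs =
    (m%:R - 1) * ((n%:R - b%:R) * S).
  by rewrite -sE natrM; field; rewrite gt_eqF.
have suffix_le (i : 'I_m) : i != Ordinal m0 ->
    enorm (\sum_(p : 'I_(m * b) | (b * i <= p)%N) gs p) ^+ 2 <= (n%:R - b%:R) * S.
  rewrite -val_eqE /= => i0; apply: le_trans (enorm_sqr_sum_le _ _) _.
  apply: ler_pM; rewrite ?ler0n //; first by apply: sumr_ge0 => p _; exact: sqr_ge0.
    have -> : #|[pred p : 'I_n | (b * i <= p)%N]|%:R =
        \sum_(p : 'I_n | (b * i <= p)%N) (1 : R) by rewrite sumr_const.
    rewrite sum_suffix_pos.
    have -> : \sum_(j < m | (i <= j)%N) \sum_(j < b) (1 : R) =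
        \sum_(j < m | (i <= j)%N) b%:R.
      by apply: eq_bigr => j _; rewrite sumr_const card_ord.
    apply: (@le_trans _ _ (\sum_(j < m | j != Ordinal m0) b%:R)); last first.
      rewrite sumr_const cardC1 card_ord -subn1 -[_ *+ _]mulr_natr natrB //.
      by rewrite natrM mulrBr mulr1 mulrC.
    rewrite [leLHS]big_mkcond [leRHS]big_mkcond ler_sum // => j _.
    case: ifP => [ij|_]; last by case: ifP.
    by rewrite -val_eqE /= -lt0n (leq_trans _ ij) // lt0n.
  rewrite /S [leRHS](bigID (fun p : 'I_(m * b) => (b * i <= p)%N)) /= lerDl.
  by apply: sumr_ge0 => p _; exact: sqr_ge0.
rewrite /suffix_dispersion (bigD1 (Ordinal m0)) //= muln0 sum_grad_opt.
rewrite enorm0 expr0n add0r.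
apply: le_trans (ler_sum _ suffix_le) _.
rewrite sumr_const -[_ *+ _]mulr_natl ler_wpM2r //.
  by rewrite mulr_ge0 // subr_ge0 ler_nat leq_pmull.
by rewrite cardC1 card_ord -subn1 natrB.
Qed.

Section Trajectory.
Variables (eta : R) (z : nat -> 'cV[R]_d).
Hypothesis eta0 : 0 < eta.
Hypothesis zS : forall i : 'I_m,
  z i.+1 = z i - (eta / b%:R) *: \sum_j grad (f (pi (pos i j))) (z i).

Local Notation w := (z m).
Local Notation g p := (grad (f (pi p)) (z (blk p))).

Lemma distance_to_end k : (k <= m)%N ->
  z k - w = (eta / b%:R) *: \sum_(p : 'I_(m * b) | (b * k <= p)%N) g p.
Proof.
move=> km; rewrite -(suffix_telescope z km) sum_suffix_pos scaler_sumr.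
apply: eq_bigr => i _; rewrite zS opprB addrC subrK; congr (_ *: _).
by apply: eq_bigr => j _; rewrite blk_pos.
Qed.

(** This turns the sum of the gradients against [w - xs] into a difference of
    squared distances to [xs], which telescopes over the epochs. *)
Lemma sum_step_gradients : \sum_p g p = (b%:R / eta) *: (z 0%N - w).
Proof.
rewrite distance_to_end // muln0 scalerA mulrA divfK ?gt_eqF //.
by rewrite divff ?gt_eqF // scale1r.
Qed.

(** For each component, cocoercivity between [z i] and [xs] and between [w] and
    [z i] produces two negative terms. The cross term pairing [h p] with [w - z i]
    is bounded batch by batch with Young's inequality, whose weight [b Lt] is
    chosen so that the batch bound cancels the negative term in [h]. *)
Lemma end_gap_le : \sum_p (f (pi p) w - f (pi p) xs) <=
  inner (\sum_p g p) (w - xs) + b%:R * Lt / 2 * \sum_(i < m) enorm (z i - w) ^+ 2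
    - 2^-1 * \sum_p enorm (g p - gs p) ^+ 2 / L (pi p).
Proof.
pose h p := grad (f (pi p)) w - g p.
have term p : f (pi p) w - f (pi p) xs <=
    inner (h p) (w - z (blk p)) + inner (g p) (w - xs)
      - 2^-1 * (enorm (g p - gs p) ^+ 2 / L (pi p))
      - 2^-1 * (enorm (h p) ^+ 2 / L (pi p)).
  have h1 := convex_smooth_bregman (z (blk p)) xs (L0 (pi p)) (f_convex _)
    (f_smooth _).
  have h2 := convex_smooth_bregman w (z (blk p)) (L0 (pi p)) (f_convex _)
    (f_smooth _).
  rewrite enorm_subC in h1; rewrite enorm_subC -/(h p) in h2.
  have e : inner (grad (f (pi p)) w) (z (blk p) - w) + inner (h p) (w - z (blk p)) =
      inner (g p) (z (blk p) - xs) - inner (g p) (w - xs).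
    by rewrite /h !innerBl !innerBr; ring.
  have {}e1 : inner (g p) (xs - z (blk p)) = - inner (g p) (z (blk p) - xs).
    by rewrite -innerNr opprB.
  have half l X : (2 * l)^-1 * X = 2^-1 * (X / l) :> R.
    by rewrite invfM -mulrA (mulrC X).
  rewrite half e1 in h1; rewrite half in h2.
  exact: gap_arith h1 h2 e.
have cross : \sum_p inner (h p) (w - z (blk p)) <=
    2^-1 * (\sum_p enorm (h p) ^+ 2 / L (pi p)) +
    b%:R * Lt / 2 * \sum_(i < m) enorm (z i - w) ^+ 2.
  have bL : 0 < b%:R * Lt := mulr_gt0 bR0 Lt0.
  rewrite sum_pos; apply: (@le_trans _ _ (\sum_(i < m)
    ((2 * (b%:R * Lt))^-1 * enorm (\sum_(j < b) h (pos i j)) ^+ 2 +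
     b%:R * Lt / 2 * enorm (z i - w) ^+ 2))).
    apply: ler_sum => i _; rewrite -(enorm_sqrN (z i - w)) opprB.
    apply: le_trans (inner_young _ _ bL); rewrite inner_suml.
    by apply: ler_sum => j _; rewrite blk_pos.
  rewrite big_split /= -!mulr_sumr lerD2r invfM -mulrA ler_pM2l ?invr_gt0 //.
  by rewrite mulrC ler_pdivrMr // mulrC batch_bound.
apply: le_trans (ler_sum _ (fun p _ => term p)) _.
have gS : inner (\sum_p g p) (w - xs) = \sum_p inner (g p) (w - xs).
  by rewrite inner_suml.
rewrite gS sum_lincomb.
exact: drift_arith cross.
Qed.

(** The iterates drift from the end of the epoch by suffix sums of the gradients;
    comparing these with the gradients at [xs] isolates the part that does not
    vanish as the iterates converge. *)
Lemma drift_le : \sum_(i < m) enorm (z i - w) ^+ 2 <= (eta / b%:R) ^+ 2 *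
  (2 * (m%:R * n%:R * Lh * \sum_p enorm (g p - gs p) ^+ 2 / L (pi p)) +
   2 * suffix_dispersion).
Proof.
under eq_bigr => i _ do rewrite distance_to_end 1?ltnW // enorm_sqrZ.
rewrite -mulr_sumr ler_wpM2l ?sqr_ge0 //.
apply: le_trans (_ : _ <= \sum_(i < m)
  (2 * enorm (\sum_(p : 'I_(m * b) | (b * i <= p)%N) (g p - gs p)) ^+ 2 +
   2 * enorm (\sum_(p : 'I_(m * b) | (b * i <= p)%N) gs p) ^+ 2)) _.
  apply: ler_sum => i _; apply: le_trans (enorm_sqrD_le _ _).
  by rewrite sumrB subrK.
by rewrite big_split /= -!mulr_sumr lerD2r ler_pM2l.
Qed.

(** The step-size condition lets the negative term left by [end_gap_le] absorb
    the part of the drift caused by the gradients differing from those at [xs]. *)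
Lemma epoch_gap_le : eta <= b%:R / (n%:R * Num.sqrt (2 * Lh * Lt)) ->
  eta * (favg f w - favg f xs) <=
    b%:R / (2 * n%:R) * (enorm (z 0%N - xs) ^+ 2 - enorm (w - xs) ^+ 2) +
    eta ^+ 3 / (b%:R * n%:R) * Lt * suffix_dispersion.
Proof.
move=> eta_le.
have step : 2 * eta ^+ 2 * n%:R ^+ 2 * Lh * Lt <= b%:R ^+ 2.
  have q0 : 0 < 2 * Lh * Lt by rewrite !mulr_gt0.
  set q := 2 * Lh * Lt in q0 eta_le.
  have s0 : 0 < n%:R * Num.sqrt q by apply: mulr_gt0; rewrite ?sqrtr_gt0.
  have le_b : eta * (n%:R * Num.sqrt q) <= b%:R by rewrite -ler_pdivlMr.
  have := lerXn2r 2 (ltW (mulr_gt0 eta0 s0)) (ltW bR0) le_b.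
  rewrite !exprMn (sqr_sqrtr (ltW q0)) => /(le_trans _); apply.
  by rewrite le_eqVlt; apply/orP; left; apply/eqP; rewrite /q; ring.
have gapE : n%:R * (favg f w - favg f xs) = \sum_p (f (pi p) w - f (pi p) xs).
  have n0 : (0 < n)%N by rewrite muln_gt0 m0.
  rewrite mulrBr !(natr_mul_favg _ _ n0) -sumrB.
  exact/esym/(sum_perm pi (fun i => f i w - f i xs)).
have threepoint : inner (\sum_p g p) (w - xs) <=
    b%:R / (2 * eta) * (enorm (z 0%N - xs) ^+ 2 - enorm (w - xs) ^+ 2).
  rewrite sum_step_gradients innerZl (_ : z 0%N - xs = (z 0%N - w) + (w - xs)).
    rewrite (enorm_sqrD (z 0%N - w)).
    have -> : b%:R / (2 * eta) = b%:R / eta / 2 by field; rewrite gt_eqF.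
    rewrite -mulrA ler_pM2l ?divr_gt0 //; have := sqr_ge0 (enorm (z 0%N - w)).
    exact: threepoint_arith.
  by rewrite addrA subrK.
set U := \sum_p enorm (g p - gs p) ^+ 2 / L (pi p).
have U0 : 0 <= U by apply: sumr_ge0 => p _; rewrite divr_ge0 ?sqr_ge0 ?ltW.
have drift : b%:R * Lt / 2 * \sum_(i < m) enorm (z i - w) ^+ 2 <=
    2^-1 * U + eta ^+ 2 / b%:R * Lt * suffix_dispersion.
  have bL : 0 <= b%:R * Lt / 2 by rewrite divr_ge0 ?mulr_ge0 ?ltW.
  apply: le_trans (ler_wpM2l bL drift_le) _; rewrite -/U.
  have -> : b%:R * Lt / 2 * ((eta / b%:R) ^+ 2 * (2 * (m%:R * n%:R * Lh * U) +
      2 * suffix_dispersion)) =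
      (2 * eta ^+ 2 * n%:R ^+ 2 * Lh * Lt) / b%:R ^+ 2 * (2^-1 * U) +
      eta ^+ 2 / b%:R * Lt * suffix_dispersion.
    by rewrite natrM; field; rewrite gt_eqF.
  rewrite lerD2r -[leRHS]mul1r ler_wpM2r ?mulr_ge0 //.
  by rewrite ler_pdivrMr ?exprn_gt0 // mul1r.
have := end_gap_le; rewrite -gapE -/U => gap.
have {}gap : n%:R * (favg f w - favg f xs) <=
    b%:R / (2 * eta) * (enorm (z 0%N - xs) ^+ 2 - enorm (w - xs) ^+ 2) +
    eta ^+ 2 / b%:R * Lt * suffix_dispersion by lra.
have en : 0 <= eta / n%:R by rewrite divr_ge0 ?ltW.
move: (ler_wpM2l en gap); rewrite mulrA divfK ?gt_eqF // => /le_trans; apply.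
rewrite le_eqVlt; apply/orP; left; apply/eqP; field.
by rewrite !gt_eqF // ltr0n.
Qed.

End Trajectory.
End Epoch.

(** * Averaging over the epochs and choice of the step size *)

Section Weights.
Context {R : realType}.

Lemma wnorm_invmx_Lambda (n d : nat) (L : 'I_n -> R) (Y : 'I_n -> 'cV[R]_d) :
  (forall i, 0 < L i) ->
  wnorm (invmx (Lambda d L 1%g)) (concat Y) ^+ 2 = \sum_i enorm (Y i) ^+ 2 / L i.
Proof.
move=> L0; pose W : 'M[R]_(n * d) := diag_mx (\row_p (L (blk p))^-1).
have LW : Lambda d L 1%g *m W = 1%:M.
  apply/matrixP => p q; rewrite mul_diag_mx !mxE perm1.
  by case: eqP => [->|_]; rewrite ?mulr0 // mulfV // gt_eqF.
have -> : invmx (Lambda d L 1%g) = W.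
  by rewrite -[LHS]mulmx1 -LW mulKmx //; case: (mulmx1_unit LW).
have E : inner (concat Y) (W *m concat Y) = \sum_i enorm (Y i) ^+ 2 / L i.
  rewrite innerE sum_pos; apply: eq_bigr => i _.
  rewrite enorm_sqr innerE mulr_suml; apply: eq_bigr => q _.
  by rewrite mul_diag_mx !mxE blk_pos off_pos; ring.
rewrite /wnorm E sqr_sqrtr //; apply: sumr_ge0 => i _.
by rewrite divr_ge0 ?sqr_ge0 ?ltW.
Qed.

(** Jensen's inequality, by averaging the tangent at the barycenter. *)
Lemma jensen_favg (n d K : nat) (f : 'I_n -> 'cV[R]_d -> R)
    (a : nat -> R) (x : nat -> 'cV[R]_d) :
  (0 < n)%N -> (forall i, convex_function [set: 'cV[R]_d] (f i)) ->
  (forall i y, differentiable (f i) y) ->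
  let H := \sum_(1 <= k < K.+1) a k in
  0 < H -> (forall k, (1 <= k <= K)%N -> 0 <= a k) ->
  H * favg f (H^-1 *: \sum_(1 <= k < K.+1) a k *: x k) <=
    \sum_(1 <= k < K.+1) a k * favg f (x k).
Proof.
move=> n0 cf df H H0 a0; set y := H^-1 *: _.
pose G : 'cV[R]_d := n%:R^-1 *: \sum_i grad (f i) y.
have tangent z : favg f y + inner G (z - y) <= favg f z.
  rewrite /favg /G innerZl inner_suml -mulrDr -big_split /=.
  rewrite ler_wpM2l ?invr_ge0 // ler_sum // => i _.
  exact: convex_ge_tangent.
apply: (@le_trans _ _ (\sum_(1 <= k < K.+1)
    (a k * favg f y + (inner G (a k *: x k) - a k * inner G y)))).
  rewrite big_split sumrB /= -!mulr_suml -inner_sumr -/H -innerZr -innerBr.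
  by rewrite scalerA mulfV ?gt_eqF // scale1r subrr inner0r addr0.
rewrite !big_nat ler_sum // => k /a0 ak.
by rewrite innerZr -mulrBr -innerBr -mulrDr ler_wpM2l.
Qed.

End Weights.

Lemma powR_three_halves (R : realType) (e : R) : 0 < e ->
  e `^ (3 / 2) = e * Num.sqrt e.
Proof.
move=> e0; rewrite -powR12_sqrt ?ltW // -{2}(powRr1 (ltW e0)) -powRD.
  by congr (_ `^ _); lra.
by rewrite gt_eqF ?implybT.
Qed.

Section StepSize.
Context {R : realType}.
Variables (n b K a s D eps : R).
Hypotheses (n0 : 0 < n) (b0 : 0 < b) (K0 : 0 < K) (a0 : 0 < a).
Hypotheses (s0 : 0 <= s) (D0 : 0 <= D) (eps0 : 0 < eps).

Local Notation q := (Num.sqrt 2 : R).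
Local Notation r := (Num.sqrt eps).

(** The step is [b] times the reciprocal of this sum. The first summand alone gives
    the largest admissible step, the second alone the step for which the noise term
    is [eps / 2]; dividing by the sum stays below both without a case distinction on
    [s] being zero. *)
Definition inverse_rate : R := n * (q * a) + q * s / r.
Local Notation T := inverse_rate.

Let q0 : 0 < q. Proof. by rewrite sqrtr_gt0. Qed.
Let r0 : 0 < r. Proof. by rewrite sqrtr_gt0. Qed.
Let qsr0 : 0 <= q * s / r.
Proof. exact: divr_ge0 (mulr_ge0 (ltW q0) s0) (ltW r0). Qed.
Let nqa0 : 0 < n * (q * a). Proof. by rewrite !mulr_gt0. Qed.
Let T0 : 0 < T. Proof. exact: ltr_pwDl. Qed.

Lemma step_admissible : 0 < b / T /\ b / T <= b / (n * (q * a)).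
Proof.
split; first by rewrite divr_gt0.
by rewrite ler_pM2l // lef_pV2 // lerDl.
Qed.

(** At this step the noise contributes at most [eps / 2] because [q * s / r <= T],
    and the distance term at most [eps / 2] because the budget [n * K] is at least
    [D * T / eps]. *)
Lemma step_reaches_eps (gap : R) :
  K * (b / T) * gap <= b / (2 * n) * D + K * ((b / T) ^+ 3 / b ^+ 2 * s ^+ 2) ->
  q * (n * a * D / eps + s * D / (eps * r)) <= n * K ->
  gap <= eps.
Proof.
have q2 : q ^+ 2 = 2 by rewrite sqr_sqrtr.
have r2 : r ^+ 2 = eps by rewrite sqr_sqrtr // ltW.
move=> gap_le nK_ge.
have first : D * T <= eps * (n * K).
  apply: le_trans (ler_wpM2l (ltW eps0) nK_ge); rewrite le_eqVlt; apply/orP; left.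
  by apply/eqP; rewrite /inverse_rate; field; rewrite !gt_eqF.
have second : s ^+ 2 <= eps / 2 * T ^+ 2.
  have sT : q * s / r <= T by rewrite lerDr (ltW nqa0).
  have := lerXn2r 2 qsr0 (ltW T0) sT.
  rewrite expr_div_n exprMn q2 r2 ler_pdivrMr // => h.
  rewrite -(ler_pM2l (_ : 0 < 2)) // (le_trans h) // le_eqVlt.
  by apply/orP; left; apply/eqP; field.
have := ler_wpM2l (ltW (divr_gt0 T0 (mulr_gt0 K0 b0))) gap_le.
rewrite (_ : T / (K * b) * (K * (b / T) * gap) = gap); last first.
  by field; rewrite !gt_eqF.
rewrite (_ : T / (K * b) * _ =
    2^-1 * (D * T) / (n * K) + s ^+ 2 / T ^+ 2); last first.
  by field; rewrite !gt_eqF.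
move=> /le_trans; apply; rewrite [leRHS](_ : _ = eps / 2 + eps / 2); last by lra.
apply: lerD; rewrite ler_pdivrMr ?mulr_gt0 ?exprn_gt0 //.
rewrite (_ : eps / 2 * _ = 2^-1 * (eps * (n * K))); last by ring.
by rewrite ler_pM2l.
Qed.

End StepSize.

Section Convergence.
Context {R : realType} {m b d : nat}.
Variables (f : 'I_(m * b) -> 'cV[R]_d -> R) (L : 'I_(m * b) -> R).
Variables (pi : 'S_(m * b)) (x0 xs : 'cV[R]_d).
Hypothesis m0 : (0 < m)%N.
Hypothesis b0 : (0 < b)%N.
Hypothesis d0 : (0 < d)%N.
Hypothesis L0 : forall i, 0 < L i.
Hypothesis f_convex : forall i, convex_function [set: 'cV[R]_d] (f i).
Hypothesis f_smooth : forall i, smooth_with (L i) (f i).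
Hypothesis xs_min : forall x, favg f xs <= favg f x.

Local Notation n := (m * b)%N.
Local Notation Lh := (Lhat d L pi).
Local Notation Lt := (Ltilde d L pi).
Local Notation ynorm := (wnorm (invmx (Lambda d L 1%g)) (ystar f xs)).

(** The error that an epoch with step [eta] can contribute: the smaller of the
    bounds that come from the two estimates of [suffix_dispersion]. *)
Definition epoch_error (eta : R) : R :=
  Num.min (eta ^+ 3 * n%:R / b%:R ^+ 2 * Lh * Lt * ynorm ^+ 2)
          (eta ^+ 3 * (n%:R - b%:R) ^+ 2 / b%:R ^+ 2 * Lt * sigma2 f xs).

Lemma ynorm_sqr : ynorm ^+ 2 = \sum_i enorm (grad (f i) xs) ^+ 2 / L i.
Proof.
rewrite /ystar wnorm_invmx_Lambda //; apply: eq_bigr => i _.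
by rewrite (argmax_fenchel _ (L0 i) (f_convex i) (f_smooth i)).
Qed.

Lemma dispersion_le_epoch_error (eta : R) : 0 < eta ->
  eta ^+ 3 / (b%:R * n%:R) * Lt * suffix_dispersion f pi xs <= epoch_error eta.
Proof.
move=> eta0; have bR : 0 < b%:R :> R by rewrite ltr0n.
have mR : 0 < m%:R :> R by rewrite ltr0n.
have nR : 0 < n%:R :> R by rewrite ltr0n muln_gt0 m0.
have Lt0 : 0 < Lt by exact: Ltilde_gt0.
have c0 : 0 <= eta ^+ 3 / (b%:R * n%:R) * Lt :=
  ltW (mulr_gt0 (divr_gt0 (exprn_gt0 3 eta0) (mulr_gt0 bR nR)) Lt0).
have h1 := suffix_dispersion_le_Lhat f xs (suffix_sum_bound pi L0 m0 b0 d0).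
rewrite -ynorm_sqr in h1.
have h2 := suffix_dispersion_le_sigma2 pi m0 b0 L0 f_smooth xs_min.
rewrite /epoch_error le_min; apply/andP; split.
  apply: le_trans (ler_wpM2l c0 h1) _; rewrite le_eqVlt; apply/orP; left; apply/eqP.
  move: (ynorm ^+ 2) Lh Lt => Y A B; rewrite natrM; field.
  by rewrite !gt_eqF.
apply: le_trans (ler_wpM2l c0 h2) _; rewrite le_eqVlt; apply/orP; left; apply/eqP.
move: (sigma2 f xs) Lt => Y B; rewrite natrM; field.
by rewrite !gt_eqF.
Qed.

Lemma epoch_progress (eta : R) (x : 'cV[R]_d) :
  0 < eta -> eta <= b%:R / (n%:R * Num.sqrt (2 * Lh * Lt)) ->
  eta * (favg f (epoch f pi eta x) - favg f xs) <=
    b%:R / (2 * n%:R) *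
      (enorm (x - xs) ^+ 2 - enorm (epoch f pi eta x - xs) ^+ 2) +
    epoch_error eta.
Proof.
move=> eta0 eta_le.
have [z [<- zS <-]] := epoch_trajectory L0 f_convex f_smooth pi x b0 eta0.
have Lh0 : 0 < Lh by exact: Lhat_gt0.
have Lt0 : 0 < Lt by exact: Ltilde_gt0.
have := epoch_gap_le xs m0 b0 L0 f_convex f_smooth Lh0 Lt0
  (suffix_sum_bound pi L0 m0 b0 d0) (batch_sum_bound pi L0 b0 d0) eta0 zS eta_le.
move=> /le_trans; apply; rewrite lerD2l; exact: dispersion_le_epoch_error.
Qed.

Lemma sgd_gap_le (K : nat) (eta : nat -> R) : (0 < K)%N ->
  (forall k, (1 <= k <= K)%N ->
    0 < eta k /\ eta k <= b%:R / (n%:R * Num.sqrt (2 * Lh * Lt))) ->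
  (\sum_(1 <= k < K.+1) eta k) *
      (favg f (sgd_output f (fun=> pi) eta x0 K) - favg f xs) <=
    b%:R / (2 * n%:R) * enorm (x0 - xs) ^+ 2 +
    \sum_(1 <= k < K.+1) epoch_error (eta k).
Proof.
move=> K0 eta_ok; set H := \sum_(1 <= k < K.+1) eta k.
have n0 : (0 < n)%N by rewrite muln_gt0 m0.
have H0 : 0 < H.
  rewrite /H big_ltn //; apply: ltr_pwDl; first by case: (eta_ok 1%N).
  rewrite big_nat; apply: sumr_ge0 => k /andP[k1 kK].
  by have [|/ltW] := eta_ok k; first by rewrite (ltnW k1).
pose x k := sgd_iter f (fun=> pi) eta x0 k.
have jensen := jensen_favg (a := eta) x n0 f_convex (fun i => (f_smooth i).1) H0
  (fun k kK => ltW (eta_ok k kK).1).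
have sums : H * favg f (sgd_output f (fun=> pi) eta x0 K) - H * favg f xs <=
    \sum_(1 <= k < K.+1) eta k * (favg f (x k) - favg f xs).
  apply: le_trans (lerB jensen (lexx _)) _; rewrite mulr_suml -sumrB.
  by apply: ler_sum => k _; rewrite -mulrBr.
rewrite mulrBr; apply: le_trans sums _.
apply: (@le_trans _ _ (\sum_(1 <= k < K.+1) (b%:R / (2 * n%:R) *
   (enorm (x k.-1 - xs) ^+ 2 - enorm (x k - xs) ^+ 2) + epoch_error (eta k)))).
  rewrite !big_nat ler_sum // => -[//|k] kK.
  exact: (epoch_progress (x k) (eta_ok _ kK).1 (eta_ok _ kK).2).
rewrite big_split /= lerD2r -mulr_sumr ler_wpM2l ?divr_ge0 ?mulr_ge0 //.
rewrite big_add1 /=.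
have -> : \sum_(0 <= k < K) (enorm (x k - xs) ^+ 2 - enorm (x k.+1 - xs) ^+ 2) =
    enorm (x0 - xs) ^+ 2 - enorm (x K - xs) ^+ 2.
  rewrite -[RHS]opprB -(telescope_sumr (fun k => enorm (x k - xs) ^+ 2) (leq0n K)).
  by rewrite -sumrN; apply: eq_bigr => k _; rewrite opprB.
by rewrite gerBl sqr_ge0.
Qed.

Local Notation sigma := (Num.sqrt (sigma2 f xs)).
Local Notation dist2 := (enorm (x0 - xs) ^+ 2).

(** Its square times [eta ^+ 3 / b ^+ 2] dominates [epoch_error eta], so it plays
    the role of the noise level in the choice of a constant step. *)
Definition error_scale : R :=
  Num.min (Num.sqrt (n%:R * Lh * Lt) * ynorm)
          ((n%:R - b%:R) * Num.sqrt Lt * sigma).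

Lemma error_scale_ge0 : 0 <= error_scale.
Proof.
rewrite /error_scale le_min !mulr_ge0 ?sqrtr_ge0 //.
by rewrite subr_ge0 ler_nat leq_pmull.
Qed.

Lemma epoch_error_le_scale (eta : R) :
  epoch_error eta <= eta ^+ 3 / b%:R ^+ 2 * error_scale ^+ 2.
Proof.
have Lh0 : 0 < Lh by exact: Lhat_gt0.
have Lt0 : 0 < Lt by exact: Ltilde_gt0.
have A0 : 0 <= n%:R * Lh * Lt :=
  mulr_ge0 (mulr_ge0 (ler0n _ _) (ltW Lh0)) (ltW Lt0).
have S0 : 0 <= sigma2 f xs.
  rewrite mulr_ge0 ?invr_ge0 ?ler0n //; apply: sumr_ge0 => i _; exact: sqr_ge0.
rewrite /error_scale minEle /epoch_error ge_min; case: ifP => _; apply/orP.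
  left; rewrite exprMn (sqr_sqrtr A0) le_eqVlt; apply/orP; left; apply/eqP.
  by move: ynorm Lh Lt => Y A B; ring.
right; rewrite !exprMn (sqr_sqrtr (ltW Lt0)) (sqr_sqrtr S0) le_eqVlt.
by apply/orP; left; apply/eqP; move: (sigma2 f xs) Lt => Y B; ring.
Qed.

Lemma sgd_complexity (eps : R) (K : nat) : 0 < eps -> (0 < K)%N ->
  Num.sqrt 2 * (n%:R * Num.sqrt (Lh * Lt) * dist2 / eps +
    error_scale * dist2 / (eps `^ (3 / 2))) <= n%:R * K%:R ->
  exists eta : R, 0 < eta /\
    favg f (sgd_output f (fun=> pi) (fun=> eta) x0 K) - favg f xs <= eps.
Proof.
move=> eps0 K0; rewrite powR_three_halves // => budget.
have bR : 0 < b%:R :> R by rewrite ltr0n.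
have KR : 0 < K%:R :> R by rewrite ltr0n.
have nR : 0 < n%:R :> R by rewrite ltr0n muln_gt0 m0.
have Lh0 : 0 < Lh by exact: Lhat_gt0.
have Lt0 : 0 < Lt by exact: Ltilde_gt0.
have a0 : 0 < Num.sqrt (Lh * Lt) by rewrite sqrtr_gt0 (mulr_gt0 Lh0 Lt0).
have [] := step_admissible nR bR a0 error_scale_ge0 eps0.
set eta := b%:R / inverse_rate _ _ _ _ => eta0 eta_le; exists eta; split=> //.
apply: (step_reaches_eps nR bR KR a0 error_scale_ge0 eps0); last exact: budget.
have sum_cst (c : R) : \sum_(1 <= k < K.+1) c = K%:R * c.
  by rewrite sumr_const_nat subSS subn0 mulr_natl.
have := sgd_gap_le (eta := fun=> eta) K0.
rewrite !sum_cst => /(_ _)/le_trans; apply.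
  by move=> k _; rewrite -mulrA sqrtrM.
by rewrite lerD2l ler_pM2l // epoch_error_le_scale.
Qed.

End Convergence.

Theorem theorem5 (R : realType) :
  exists C : R, 0 < C /\
  forall (n m b d : nat) (f : 'I_(m * b) -> 'cV[R]_d -> R)
    (L : 'I_(m * b) -> R) (pi0 : 'S_(m * b)) (x0 xs : 'cV[R]_d),
    (0 < m)%N -> (0 < b)%N -> (0 < d)%N -> n = (b * m)%N ->
    (forall i, 0 < L i) ->
    (forall i, convex_function [set: 'cV[R]_d] (f i)) ->
    (forall i, smooth_with (L i) (f i)) ->
    (forall x, favg f xs <= favg f x) ->
    let Lh := Lhat d L pi0 in
    let Lt := Ltilde d L pi0 in
    let ynorm := wnorm (invmx (Lambda d L 1%g)) (ystar f xs) in
    let sigma := Num.sqrt (sigma2 f xs) in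
    let dist2 := enorm (x0 - xs) ^+ 2 in
    (forall (K : nat) (eta : nat -> R),
      (0 < K)%N ->
      (forall k, (1 <= k <= K)%N ->
        0 < eta k /\ eta k <= b%:R / (n%:R * Num.sqrt (2 * Lh * Lt))) ->
      let H := \sum_(1 <= k < K.+1) eta k in
      let xhat := sgd_output f (fun=> pi0) eta x0 K in
      H * (favg f xhat - favg f xs) <=
        b%:R / (2 * n%:R) * dist2 +
        \sum_(1 <= k < K.+1)
          Num.min (eta k ^+ 3 * n%:R / b%:R ^+ 2 * Lh * Lt * ynorm ^+ 2)
                  (eta k ^+ 3 * (n%:R - b%:R) ^+ 2 / b%:R ^+ 2
                     * Lt * sigma2 f xs)) /\
    (forall (eps : R) (K : nat),
      0 < eps -> (0 < K)%N ->
      C * (n%:R * Num.sqrt (Lh * Lt) * dist2 / eps +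
           Num.min (Num.sqrt (n%:R * Lh * Lt) * ynorm)
                   ((n%:R - b%:R) * Num.sqrt Lt * sigma)
             * dist2 / (eps `^ (3 / 2))) <= n%:R * K%:R ->
      exists eta : R, 0 < eta /\
        favg f (sgd_output f (fun=> pi0) (fun=> eta) x0 K) - favg f xs <= eps).
Proof.
exists (Num.sqrt 2); split; first by rewrite sqrtr_gt0.
move=> n m b d f L pi0 x0 xs m0 b0 d0 -> L0 f_convex f_smooth xs_min.
rewrite (mulnC b m) => Lh Lt ynorm sigma dist2; split=> [K eta|eps K].
  exact: sgd_gap_le.
exact: sgd_complexity.
Qed.
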